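(* Let $(H,\xi_H)$ be a monoidal Hom-Hopf algebra with bijective antipode $S$ over a field $k$, and let $\mathcal{ZMHYD}(H)$ be the disjoint union, over $n\in\mathbb Z$, of the categories ${}_H\mathcal{MHYD}^H(S^{2n},\mathrm{id})$ of left-right $n$-Yetter-Drinfeld Hom-modules. Then $\mathcal{ZMHYD}(H)$ is a braided $T$-category over $\mathbb Z$.
   Context: Everything is over a field $k$. The monoidal Hom-category $\widetilde{\mathcal H}(\mathcal M_k)$ has objects $(M,\xi_M)$ ($M$ a $k$-vector space, $\xi_M$ a linear automorphism), morphisms the linear maps commuting with the automorphisms, tensor product $(M\otimes N,\xi_M\otimes\xi_N)$, unit $(k,\mathrm{id})$, associativity constraint $(m\otimes n)\otimes l\mapsto\xi_M(m)\otimes(n\otimes\xi_L^{-1}(l))$ and unit constraints $1\otimes m\mapsto\xi_M(m)$, $m\otimes1\mapsto\xi_M(m)$. A monoidal Hom-Hopf algebra $(H,\xi_H)$ has a product with unit $1_H$, a coproduct $\Delta(h)=h_1\otimes h_2$, counit $\varepsilon$ and antipode $S$, all commuting with (resp. preserved by) $\xi_H$, with $\xi_H(a)(bc)=(ab)\xi_H(c)$, $a1_H=1_Ha=\xi_H(a)$, $\xi_H^{-1}(c_1)\otimes\Delta(c_2)=\Delta(c_1)\otimes\xi_H^{-1}(c_2)$, $c_1\varepsilon(c_2)=\xi_H^{-1}(c)=\varepsilon(c_1)c_2$, $\Delta,\varepsilon$ multiplicative and unital, $S(h_1)h_2=\varepsilon(h)1_H=h_1S(h_2)$. Left $H$-Hom-module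 $(M,\xi_M)$: $\xi_H(a)\cdot(b\cdot m)=(ab)\cdot\xi_M(m)$, $\xi_M(a\cdot m)=\xi_H(a)\cdot\xi_M(m)$, $1_H\cdot m=\xi_M(m)$. Right $H$-Hom-comodule $(M,\xi_M)$ with $\rho(m)=m_0\otimes m_1$: $\xi_M^{-1}(m_0)\otimes\Delta(m_1)=m_{00}\otimes m_{01}\otimes\xi_H^{-1}(m_1)$, $\rho\xi_M=(\xi_M\otimes\xi_H)\rho$, $m_0\varepsilon(m_1)=\xi_M^{-1}(m)$. An object of ${}_H\mathcal{MHYD}^H(S^{2n},\mathrm{id})$ (a left-right $n$-Yetter-Drinfeld Hom-module) is $(M,\xi_M)$ that is a left $H$-Hom-module and a right $H$-Hom-comodule with $$(h\cdot m)_0\otimes(h\cdot m)_1=\xi_H(h_{21})\cdot m_0\otimes(h_{22}\xi_H^{-1}(m_1))S^{2n-1}(h_1);$$ morphisms are the $H$-linear and $H$-colinear maps. Structure on $\mathcal{ZMHYD}(H)$: for $M$ in component $m$ and $N$ in component $n$, the tensor product $(M\otimes N,\xi_M\otimes\xi_N)$ lies in component $m+n$ with $h\cdot(x\otimes y)=S^{2n}(h_1)\cdot x\otimes h_2\cdot y$ and coaction $x\otimes y\mapsto(x_0\otimes y_0)\otimes y_1x_1$; unit object $k$ with trivial structures and constraints as in $\widetilde{\mathcal H}(\mathcal M_k)$; the conjugation by $m\in\mathbb Z$ sends $N$ to ${}^mN=N$ with action $h\unrhd y=S^{-2m}(h)\cdot y$ and coaction $y\mapsto y_0\otimes S^{2m}(y_1)$;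 the braiding $c_{M,N}:M\otimes N\to{}^mN\otimes M$ is $c_{M,N}(x\otimes y)=\xi_N(y_0)\otimes y_1\cdot\xi_M^{-1}(x)$. Crossed category over a group $G$: a monoidal category $\mathcal C$ (associativity constraint $a$) that is a disjoint union of subcategories $\mathcal C_\alpha$ ($\alpha\in G$), with $U\otimes V\in\mathcal C_{\alpha\beta}$ for $U\in\mathcal C_\alpha,V\in\mathcal C_\beta$, and a group homomorphism $\varphi:G\to\mathrm{Aut}(\mathcal C)$ into invertible strict tensor functors with $\varphi_\beta(\mathcal C_\alpha)=\mathcal C_{\beta\alpha\beta^{-1}}$. For $U\in\mathcal C_\alpha$ write ${}^U(\cdot)={}^\alpha(\cdot)=\varphi_\alpha$. A braiding is a family of isomorphisms $c_{U,V}:U\otimes V\to{}^UV\otimes U$ such that $({}^\alpha g\otimes f)c_{U,V}=c_{U',V'}(f\otimes g)$ for $f:U\to U'$ in $\mathcal C_\alpha$ and $g:V\to V'$; $c_{U\otimes V,W}=a_{{}^{U\otimes V}W,U,V}(c_{U,{}^VW}\otimes\mathrm{id}_V)a^{-1}_{U,{}^VW,V}(\mathrm{id}_U\otimes c_{V,W})a_{U,V,W}$; $c_{U,V\otimes W}=a^{-1}_{{}^UV,{}^UW,U}(\mathrm{id}\otimes c_{U,W})a_{{}^UV,U,W}(c_{U,V}\otimes\mathrm{id}_W)a^{-1}_{U,V,W}$; and $\varphi_\beta(c_{U,V})=c_{\varphi_\beta(U),\varphi_\beta(V)}$. A braided $T$-category over $G$ is a crossed category over $G$ with a braiding. *)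

(* Defs.v *)
From HB Require Import structures.
From mathcomp Require Import all_boot all_order all_algebra.
From mathcomp Require Import boolp classical_sets.

Set Implicit Arguments.
Unset Strict Implicit.
Unset Printing Implicit Defensive.

Import GRing.Theory.

Local Open Scope ring_scope.
Local Open Scope quotient_scope.

Declare Scope tensor_scope.
Delimit Scope tensor_scope with T.
Local Open Scope tensor_scope.

Definition bilin (K : fieldType) (U V W : lmodType K) (f : U -> V -> W) : Prop :=
  (forall v, linear (f^~ v)) /\ (forall u, linear (f u)).

(* The inverse of a bijection, made total: for bijective f this is the inverse
   map, see [binvK] and [binvKV]; it is meaningless otherwise. *)
Definition binv (U V : choiceType) (u0 : U) (f : U -> V) (y : V) : U :=
  xget u0 [set x | f x = y]%classic.

Lemma binvK (U V : choiceType) (u0 : U) (f : U -> V) :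
  bijective f -> cancel f (binv u0 f).
Proof.
move=> /bij_inj f_inj x; apply: f_inj; rewrite /binv.
by case: xgetP => [? _ ->|/(_ x)] //; case.
Qed.

Lemma binvKV (U V : choiceType) (u0 : U) (f : U -> V) :
  bijective f -> cancel (binv u0 f) f.
Proof.
move=> [g fK gK] y; rewrite /binv.
by case: xgetP => [? _ ->|/(_ (g y))] //; case; exact: gK.
Qed.

(* f^z for z : int and f a bijection. *)
Definition zpow (U : zmodType) (f : U -> U) (z : int) : U -> U :=
  match z with
  | Posz n => iter n f
  | Negz n => iter n.+1 (binv 0 f)
  end.

(* Tensor product of two vector spaces of arbitrary dimension: formal finite
   sums of pairs (m, n), as lists, modulo the congruence generated by
   commutativity and by the bilinearity relations. *)
Section Tensor.
Variables (K : fieldType) (M N : lmodType K).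

Inductive tens_eqv : seq (M * N) -> seq (M * N) -> Prop :=
| TE_refl s : tens_eqv s s
| TE_sym s t : tens_eqv s t -> tens_eqv t s
| TE_trans t s u : tens_eqv s t -> tens_eqv t u -> tens_eqv s u
| TE_cat s s' t t' : tens_eqv s s' -> tens_eqv t t' -> tens_eqv (s ++ t) (s' ++ t')
| TE_comm s t : tens_eqv (s ++ t) (t ++ s)
| TE_addl m m' n : tens_eqv [:: (m + m', n)] [:: (m, n); (m', n)]
| TE_addr m n n' : tens_eqv [:: (m, n + n')] [:: (m, n); (m, n')]
| TE_scale a m n : tens_eqv [:: (a *: m, n)] [:: (m, a *: n)]
| TE_zero n : tens_eqv [:: (0, n)] [::].

Definition tens_rel (s t : seq (M * N)) : bool := `[< tens_eqv s t >].

Fact tens_rel_refl : reflexive tens_rel.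
Proof. by move=> s; apply/asboolP; exact: TE_refl. Qed.

Fact tens_rel_sym : symmetric tens_rel.
Proof. by move=> s t; apply/asboolP/asboolP; exact: TE_sym. Qed.

Fact tens_rel_trans : transitive tens_rel.
Proof.
by move=> t s u /asboolP st /asboolP tu; apply/asboolP; exact: TE_trans tu.
Qed.

Canonical tens_equiv := EquivRel tens_rel tens_rel_refl tens_rel_sym tens_rel_trans.
Canonical tens_equiv_direct := defaultEncModRel tens_rel.

Definition tensor := {eq_quot tens_rel}.

HB.instance Definition _ := Quotient.on tensor.
HB.instance Definition _ := Choice.on tensor.
HB.instance Definition _ : EqQuotient _ tens_rel tensor := EqQuotient.on tensor.

Definition tcls (s : seq (M * N)) : tensor := \pi_tensor s.

Lemma tclsP s t : tcls s = tcls t <-> tens_eqv s t.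
Proof. by split=> [/eqmodP/asboolP|] // st; apply/eqmodP/asboolP. Qed.

Lemma repr_tcls s : tens_eqv (repr (tcls s)) s.
Proof. by apply/tclsP; rewrite /tcls reprK. Qed.

Lemma tcls_repr t : tcls (repr t) = t.
Proof. by rewrite /tcls reprK. Qed.

Definition tadd (s t : tensor) : tensor := tcls (repr s ++ repr t).
Definition tscale (a : K) (t : tensor) : tensor :=
  tcls [seq (a *: p.1, p.2) | p <- repr t].
Definition topp (t : tensor) : tensor := tscale (-1) t.

Lemma taddE s t : tadd (tcls s) (tcls t) = tcls (s ++ t).
Proof. by apply/tclsP; apply: TE_cat; exact: repr_tcls. Qed.

Lemma tens_eqv_scale a s t : tens_eqv s t ->
  tens_eqv [seq (a *: p.1, p.2) | p <- s] [seq (a *: p.1, p.2) | p <- t].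
Proof.
elim=> {s t} [s|s t _|t s u _ st _ tu|s s' t t' _ ss _ tt|s t|m m' n|m n n'|b m n|n] /=.
- exact: TE_refl.
- exact: TE_sym.
- exact: TE_trans tu.
- by rewrite !map_cat; exact: TE_cat.
- by rewrite !map_cat; exact: TE_comm.
- by rewrite scalerDr; exact: TE_addl.
- exact: TE_addr.
- by rewrite scalerA mulrC -scalerA; exact: TE_scale.
- by rewrite scaler0; exact: TE_zero.
Qed.

Lemma tscaleE a s : tscale a (tcls s) = tcls [seq (a *: p.1, p.2) | p <- s].
Proof. by apply/tclsP; apply: tens_eqv_scale; exact: repr_tcls. Qed.

Fact taddA : associative tadd.
Proof.
move=> x y z; rewrite -[x]tcls_repr -[y]tcls_repr -[z]tcls_repr.
by rewrite !taddE catA.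
Qed.

Fact taddC : commutative tadd.
Proof.
move=> x y; rewrite -[x]tcls_repr -[y]tcls_repr !taddE.
by apply/tclsP; exact: TE_comm.
Qed.

Fact tadd0 : left_id (tcls [::]) tadd.
Proof. by move=> x; rewrite -[x]tcls_repr taddE. Qed.

Lemma tens_eqv_scaleD a b s :
  tens_eqv [seq ((a + b) *: p.1, p.2) | p <- s]
           ([seq (a *: p.1, p.2) | p <- s] ++ [seq (b *: p.1, p.2) | p <- s]).
Proof.
elim: s => [|p s IHs] /=; first exact: TE_refl.
rewrite scalerDl.
apply: (@TE_trans ([:: (a *: p.1, p.2); (b *: p.1, p.2)] ++
  ([seq (a *: p.1, p.2) | p <- s] ++ [seq (b *: p.1, p.2) | p <- s]))).
  by apply: (@TE_cat [:: _] [:: _; _]) => //; exact: TE_addl.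
set A := map _ s; set B := map _ s.
apply: (@TE_cat [:: (a *: p.1, p.2)] [:: (a *: p.1, p.2)]
          ((b *: p.1, p.2) :: A ++ B) (A ++ (b *: p.1, p.2) :: B)).
  exact: TE_refl.
rewrite -(cat1s _ (A ++ B)) -(cat1s _ B) !catA.
by apply: TE_cat; [exact: TE_comm|exact: TE_refl].
Qed.

Fact taddN : left_inverse (tcls [::]) topp tadd.
Proof.
move=> x; rewrite -[x]tcls_repr /topp tscaleE taddE; apply/tclsP.
set s := repr x.
have e1 : s = [seq (1 *: p.1, p.2) | p <- s].
  by rewrite -[LHS]map_id; apply: eq_map => p; rewrite scale1r -surjective_pairing.
rewrite {2}e1; apply: TE_trans (TE_sym (tens_eqv_scaleD _ _ _)) _.
rewrite addNr; elim: s {e1} => [|p s IHs] /=; first exact: TE_refl.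
rewrite scale0r.
by apply: (@TE_cat [:: _] [::] _ [::]) => //; exact: TE_zero.
Qed.

HB.instance Definition _ := GRing.isZmodule.Build tensor taddA taddC tadd0 taddN.

Fact tscaleA a b x : tscale a (tscale b x) = tscale (a * b) x.
Proof.
rewrite -[x]tcls_repr !tscaleE -map_comp; congr tcls.
by apply: eq_map => p /=; rewrite scalerA.
Qed.

Fact tscale1 : left_id 1 tscale.
Proof.
move=> x; rewrite -[x]tcls_repr !tscaleE; congr tcls.
by rewrite -[RHS]map_id; apply: eq_map => p; rewrite scale1r -surjective_pairing.
Qed.

Fact tscaleDr : right_distributive tscale +%R.
Proof.
move=> a x y; rewrite -[x]tcls_repr -[y]tcls_repr.
by rewrite /GRing.add /= taddE !tscaleE taddE map_cat.
Qed.

Fact tscaleDl x : {morph tscale^~ x : a b / a + b}.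
Proof.
move=> a b; rewrite -[x]tcls_repr !tscaleE.
by rewrite [RHS]taddE; apply/tclsP; exact: tens_eqv_scaleD.
Qed.

HB.instance Definition _ :=
  GRing.Zmodule_isLmodule.Build K tensor tscaleA tscale1 tscaleDr tscaleDl.

Definition tpure (m : M) (n : N) : tensor := tcls [:: (m, n)].

(* [tsum f t] is the value at t of the linear map M ⊗ N -> V induced by f: the
   sum of the f m n over a decomposition of t into pure tensors m ⊗ n. It does
   not depend on the decomposition when f is bilinear ([tsumE]); it is only
   used for such f. *)
Definition tsum (V : zmodType) (f : M -> N -> V) (t : tensor) : V :=
  \sum_(p <- repr t) f p.1 p.2.

Lemma tpure_bilin : bilin tpure.
Proof.
have sc a m n : tpure (a *: m) n = a *: tpure m n.
  by rewrite [RHS]tscaleE.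
split=> [n a m m'|m a n n'].
  by rewrite -sc [RHS]taddE; apply/tclsP; exact: TE_addl.
rewrite -sc [RHS]taddE; apply/tclsP; apply: TE_trans (TE_addr _ _ _) _.
apply: (@TE_cat [:: (m, a *: n)] [:: (a *: m, n)] [:: (m, n')] [:: (m, n')]).
  by apply: TE_sym; exact: TE_scale.
exact: TE_refl.
Qed.

Lemma tensor_decomp (t : tensor) : t = \sum_(p <- repr t) tpure p.1 p.2.
Proof.
rewrite -[LHS]tcls_repr; elim: (repr t) => [|p s IHs]; first by rewrite big_nil.
rewrite big_cons -IHs [RHS]taddE; congr tcls.
by rewrite /= -surjective_pairing.
Qed.

Section Universal.
Variables (V : lmodType K) (f : M -> N -> V).
Hypothesis f_bilin : bilin f.

Lemma tens_eqv_sum s t : tens_eqv s t ->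
  \sum_(p <- s) f p.1 p.2 = \sum_(p <- t) f p.1 p.2.
Proof.
have [fl fr] := f_bilin.
have f0 n : f 0 n = 0.
  by have := fl n (-1) 0 0; rewrite /= scaler0 addr0 => ->; rewrite scaleN1r addNr.
have f0r m : f m 0 = 0.
  by have := fr m (-1) 0 0; rewrite scaler0 addr0 => ->; rewrite scaleN1r addNr.
elim=> {s t} [s|s t _|t s u _ st _ tu|s s' t t' _ ss _ tt|s t|m m' n|m n n'|b m n|n] //.
- exact: etrans tu.
- by rewrite !big_cat /= ss tt.
- by rewrite !big_cat /= addrC.
- by rewrite !big_cons !big_nil /= !addr0 -[m]scale1r fl /= !scale1r.
- by rewrite !big_cons !big_nil /= !addr0 -[n]scale1r fr /= !scale1r.
- rewrite !big_cons !big_nil /= !addr0 -[b *: m]addr0 -[b *: n]addr0 fl fr.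
  by rewrite f0 f0r.
- by rewrite !big_cons !big_nil f0 addr0.
Qed.

Lemma tsumE m n : tsum f (tpure m n) = f m n.
Proof. by rewrite /tsum (tens_eqv_sum (repr_tcls _)) big_seq1. Qed.

Lemma tsum_linear : linear (tsum f).
Proof.
move=> a x y; rewrite -[x]tcls_repr -[y]tcls_repr.
rewrite [a *: _]tscaleE [X in tsum f X]taddE /tsum.
rewrite !(tens_eqv_sum (repr_tcls _)) big_cat /= big_map; congr (_ + _).
rewrite scaler_sumr; apply: eq_bigr => p _ /=.
have [fl _] := f_bilin.
have f0 n : f 0 n = 0.
  by have := fl n (-1) 0 0; rewrite /= scaler0 addr0 => ->; rewrite scaleN1r addNr.
by rewrite -[a *: p.1]addr0 fl f0 addr0.
Qed.

Lemma tsum_unique (g : tensor -> V) :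
  linear g -> (forall m n, g (tpure m n) = f m n) -> g =1 tsum f.
Proof.
move=> gl gE t; pose gL : {linear tensor -> V} :=
  HB.pack g (GRing.isLinear.Build K _ _ _ g gl).
rewrite [t in LHS]tensor_decomp -[g]/(gL : _ -> _) linear_sum /tsum.
by apply: eq_bigr => p _; exact: gE.
Qed.

End Universal.
End Tensor.

Notation "m ⊗ n" := (tpure m n)
  (at level 40, left associativity) : tensor_scope.
(* Sweedler notation: [\Sw_(x, y <- t) E] is E with x ⊗ y standing for t. *)
Notation "\Sw_ ( x , y <- t ) E" := (tsum (fun x y => E) t)
  (at level 41, x name, y name, t at level 200, E at level 41,
   format "\Sw_ ( x ,  y  <-  t )  E") : tensor_scope.

Definition tmap (K : fieldType) (M M' N N' : lmodType K)
    (f : M -> M') (g : N -> N') (t : tensor M N) : tensor M' N' :=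
  \Sw_(m, n <- t) f m ⊗ g n.

Section TensorMap.
Variable K : fieldType.
Implicit Types M N : lmodType K.

Lemma tpure_comp_bilin M M' N N' (f : M -> M') (g : N -> N') :
  linear f -> linear g -> bilin (fun m n => f m ⊗ g n).
Proof.
have [pl pr] := tpure_bilin M' N'.
by move=> fl gl; split=> [n a x y|m a x y] /=; rewrite ?fl ?gl ?pl ?pr.
Qed.

Lemma tmap_linear M M' N N' (f : M -> M') (g : N -> N') :
  linear f -> linear g -> linear (tmap f g).
Proof. by move=> fl gl; apply: tsum_linear; exact: tpure_comp_bilin. Qed.

Lemma tmapE M M' N N' (f : M -> M') (g : N -> N') m n :
  linear f -> linear g -> tmap f g (m ⊗ n) = f m ⊗ g n.
Proof. by move=> fl gl; rewrite /tmap tsumE //; exact: tpure_comp_bilin. Qed.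

Lemma tmap_id M N : tmap (@id M) (@id N) =1 id.
Proof.
move=> t; apply/esym/(@tsum_unique _ _ _ _ (fun m n => m ⊗ n)) => //.
Qed.

Lemma tmap_comp M M' M'' N N' N'' (f : M -> M') (f' : M' -> M'')
    (g : N -> N') (g' : N' -> N'') :
  linear f -> linear f' -> linear g -> linear g' ->
  tmap (f' \o f) (g' \o g) =1 tmap f' g' \o tmap f g.
Proof.
move=> fl fl' gl gl' t; apply/esym.
apply: (@tsum_unique _ _ _ _ (fun m n => (f' \o f) m ⊗ (g' \o g) n)).
  by move=> a x y /=; rewrite !tmap_linear.
by move=> m n /=; rewrite !tmapE.
Qed.

HB.instance Definition _ M M' N N'
    (f : {linear M -> M'}) (g : {linear N -> N'}) :=
  GRing.isLinear.Build K (tensor M N) (tensor M' N') *:%R (tmap f g)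
    (tmap_linear (@linearP _ _ _ _ f) (@linearP _ _ _ _ g)).

End TensorMap.

Record homSpace (K : fieldType) := HomSpace {
  hcar :> lmodType K;
  xi : {linear hcar -> hcar};
  xi_bij : bijective xi }.
Arguments xi {K} M : rename.
Definition xiV (K : fieldType) (M : homSpace K) : M -> M := binv 0 (xi M).
Arguments xiV {K} M _.

Section HomSpaceTensor.
Variable K : fieldType.

Lemma linear_can (V W : lmodType K) (f : {linear V -> W}) (g : W -> V) :
  cancel f g -> cancel g f -> linear g.
Proof. by move=> fK gK a x y; apply: (can_inj fK); rewrite linearP !gK. Qed.

Fact htens_bij (M N : homSpace K) : bijective (tmap (xi M) (xi N)).
Proof.
have [f fK Kf] := xi_bij M; have [g gK Kg] := xi_bij N.
have fl := linear_can fK Kf; have gl := linear_can gK Kg.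
have xl P : linear (xi P : hcar P -> hcar P) := @linearP _ _ _ _ (xi P).
exists (tmap f g) => t; rewrite -[LHS](tmap_comp _ _ _ _ t) //.
  rewrite -[RHS](tmap_id t); congr (tmap _ _ t); apply/funext => x /=.
  - exact: fK.
  - exact: gK.
rewrite -[RHS](tmap_id t); congr (tmap _ _ t); apply/funext => x /=.
- exact: Kf.
- exact: Kg.
Qed.

Definition htens (M N : homSpace K) : homSpace K := HomSpace (htens_bij M N).

Fact hunit_bij : bijective (@idfun K^o).
Proof. by exists idfun. Qed.

Definition hunit : homSpace K := @HomSpace K K^o idfun hunit_bij.

(* Constraints of the monoidal Hom-category. *)
Definition hassoc (L M N : homSpace K) (t : htens (htens L M) N) :
    htens L (htens M N) :=
  \Sw_(u, n <- t) \Sw_(l, m <- u) xi L l ⊗ (m ⊗ xiV N n).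

Definition hassocV (L M N : homSpace K) (t : htens L (htens M N)) :
    htens (htens L M) N :=
  \Sw_(l, u <- t) \Sw_(m, n <- u) (xiV L l ⊗ m) ⊗ xi N n.

Definition hlunit (M : homSpace K) (t : htens hunit M) : M :=
  tsum (fun (a : K^o) (m : M) => (a : K) *: xi M m) t.

Definition hrunit (M : homSpace K) (t : htens M hunit) : M :=
  tsum (fun (m : M) (a : K^o) => (a : K) *: xi M m) t.

End HomSpaceTensor.

(* Triple tensors in the coassociativity axioms, here and for comodules, are
   compared in U ⊗ (V ⊗ W) along the plain rebracketing, without xi. *)
Record homHopf (K : fieldType) := HomHopf {
  hsp :> homSpace K;
  hmul : hsp -> hsp -> hsp;
  hone : hsp;
  hdelta : {linear hsp -> tensor hsp hsp};
  heps : {linear hsp -> K^o};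
  hS : {linear hsp -> hsp};
  hmul_bilin : bilin hmul;
  hmul_xi : forall a b, xi hsp (hmul a b) = hmul (xi hsp a) (xi hsp b);
  hone_xi : xi hsp hone = hone;
  hdelta_xi : forall c, hdelta (xi hsp c) = \Sw_(c1, c2 <- hdelta c) xi hsp c1 ⊗ xi hsp c2;
  heps_xi : forall c, heps (xi hsp c) = heps c;
  hS_xi : forall h, hS (xi hsp h) = xi hsp (hS h);
  hmulA : forall a b c, hmul (xi hsp a) (hmul b c) = hmul (hmul a b) (xi hsp c);
  hmul1r : forall a, hmul a hone = xi hsp a;
  hmul1l : forall a, hmul hone a = xi hsp a;
  hdeltaA : forall c,
    \Sw_(c1, c2 <- hdelta c) \Sw_(c21, c22 <- hdelta c2) xiV hsp c1 ⊗ (c21 ⊗ c22)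
    = \Sw_(c1, c2 <- hdelta c) \Sw_(c11, c12 <- hdelta c1) c11 ⊗ (c12 ⊗ xiV hsp c2);
  hepsr : forall c, \Sw_(c1, c2 <- hdelta c) (heps c2 : K) *: c1 = xiV hsp c;
  hepsl : forall c, \Sw_(c1, c2 <- hdelta c) (heps c1 : K) *: c2 = xiV hsp c;
  hdeltaM : forall a b, hdelta (hmul a b) =
    \Sw_(a1, a2 <- hdelta a) \Sw_(b1, b2 <- hdelta b) hmul a1 b1 ⊗ hmul a2 b2;
  hdelta1 : hdelta hone = hone ⊗ hone;
  hepsM : forall a b, heps (hmul a b) = (heps a : K) * (heps b : K);
  heps1 : heps hone = 1 :> K;
  hSl : forall h, \Sw_(h1, h2 <- hdelta h) hmul (hS h1) h2 = (heps h : K) *: hone;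
  hSr : forall h, \Sw_(h1, h2 <- hdelta h) hmul h1 (hS h2) = (heps h : K) *: hone }.

Definition antipode (K : fieldType) (H : homHopf K) : H -> H := hS H.
Arguments antipode {K} H _.

Section YetterDrinfeld.
Variables (K : fieldType) (H : homHopf K).

Local Notation "a ·H b" := (@hmul K H a b) (at level 40, left associativity).
Local Notation Delta := (hdelta H).
Local Notation epsilon h := (heps H h : K).

Definition Spow (n : int) : H -> H := zpow (antipode H) n.

(* An object of the Hom-category with maps that are candidates for an action
   and a coaction; the axioms are the predicates below. *)
Record ydData := YdData {
  ysp :> homSpace K;
  act : H -> ysp -> ysp;
  coact : ysp -> tensor ysp H }.

Record is_hom_module (M : ydData) : Prop := IsHomModule {
  act_bilin : bilin (@act M);
  actA : forall a b (m : M), act (xi H a) (act b m) = act (a ·H b) (xi M m);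
  act_xi : forall a (m : M), xi M (act a m) = act (xi H a) (xi M m);
  act1 : forall m : M, act (hone H) m = xi M m }.

Record is_hom_comodule (M : ydData) : Prop := IsHomComodule {
  coact_linear : linear (@coact M);
  coactA : forall m : M,
    \Sw_(m0, m1 <- coact m) \Sw_(m11, m12 <- Delta m1) xiV M m0 ⊗ (m11 ⊗ m12)
    = \Sw_(m0, m1 <- coact m) \Sw_(m00, m01 <- coact m0) m00 ⊗ (m01 ⊗ xiV H m1);
  coact_xi : forall m : M,
    coact (xi M m) = \Sw_(m0, m1 <- coact m) xi M m0 ⊗ xi H m1;
  coact_eps : forall m : M,
    \Sw_(m0, m1 <- coact m) epsilon m1 *: m0 = xiV M m }.

(* Left-right n-Yetter-Drinfeld Hom-modules. *)
Record is_yd (n : int) (M : ydData) : Prop := IsYd {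
  yd_module : is_hom_module M;
  yd_comodule : is_hom_comodule M;
  yd_compat : forall h (m : M),
    coact (act h m) =
    \Sw_(h1, h2 <- Delta h) \Sw_(h21, h22 <- Delta h2) \Sw_(m0, m1 <- coact m)
      act (xi H h21) m0 ⊗ ((h22 ·H xiV H m1) ·H Spow (2 * n - 1) h1) }.

(* The disjoint union over n : int of the categories of n-Yetter-Drinfeld
   Hom-modules: an object carries its component, and morphisms only exist
   inside a component. Commutation of a morphism with xi is H-linearity at
   [hone H], by [act1]. *)
Record zobj := ZObj {
  zdeg : int;
  zdat :> ydData;
  zobjP : is_yd zdeg zdat }.

Record is_zmor (M N : zobj) (f : M -> N) : Prop := IsZmor {
  zmor_deg : zdeg M = zdeg N;
  zmor_linear : linear f;
  zmor_act : forall h (m : M), f (act h m) = act h (f m);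
  zmor_coact : forall m : M, coact (f m) = \Sw_(m0, m1 <- coact m) f m0 ⊗ m1 }.

Record zmor (M N : zobj) := ZMor {
  zfun :> M -> N;
  zmorP : is_zmor zfun }.

Lemma zmor_eq (M N : zobj) (f g : zmor M N) : zfun f =1 zfun g -> f = g.
Proof.
case: f g => [f fP] [g gP] /= /funext fg; move: gP; rewrite -fg => gP.
by rewrite (Prop_irrelevance fP gP).
Qed.

Fact zid_mor (M : zobj) : is_zmor (@id M).
Proof. by split=> // m; rewrite -[LHS](tmap_id (coact m)). Qed.

Fact zcomp_mor (L M N : zobj) (g : zmor M N) (f : zmor L M) :
  is_zmor (fun x : L => g (f x)).
Proof.
case: g f => [g [gd gl ga gc]] [f [fd fl fa fc]] /=; split.
- exact: etrans gd.
- by move=> a x y; rewrite fl gl.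
- by move=> h x; rewrite fa ga.
- move=> x; rewrite gc fc.
  have idl : linear (@id H) by [].
  exact/esym/(tmap_comp fl gl idl idl).
Qed.

Definition zid (M : zobj) : zmor M M := ZMor (zid_mor M).
Definition zcomp (L M N : zobj) (g : zmor M N) (f : zmor L M) : zmor L N :=
  ZMor (zcomp_mor g f).

(* Raw structure maps: tensor product (n is the component of the right
   factor), unit, conjugation and braiding. *)
Definition yd_tens (n : int) (M N : ydData) : ydData :=
  @YdData (htens M N)
    (fun h t => \Sw_(h1, h2 <- Delta h) \Sw_(x, y <- t)
       act (Spow (2 * n) h1) x ⊗ act h2 y)
    (fun t => \Sw_(x, y <- t) \Sw_(x0, x1 <- coact x) \Sw_(y0, y1 <- coact y)
       (x0 ⊗ y0) ⊗ (y1 ·H x1)).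

Definition yd_unit : ydData :=
  @YdData (hunit K) (fun h x => epsilon h *: x) (fun x => x ⊗ hone H).

Definition yd_conj (m : int) (N : ydData) : ydData :=
  @YdData N
    (fun h y => act (Spow (- (2 * m)) h) y)
    (fun y => \Sw_(y0, y1 <- coact y) y0 ⊗ Spow (2 * m) y1).

Definition yd_braid (M N : ydData) (t : htens M N) : htens N M :=
  \Sw_(x, y <- t) \Sw_(y0, y1 <- coact y) xi N y0 ⊗ act y1 (xiV M x).

End YetterDrinfeld.

Record category := Category {
  cob :> Type;
  chom : cob -> cob -> Type;
  cid : forall X, chom X X;
  ccomp : forall X Y Z, chom Y Z -> chom X Y -> chom X Z;
  ccompA : forall W X Y Z (h : chom Y Z) (g : chom X Y) (f : chom W X),
    ccomp h (ccomp g f) = ccomp (ccomp h g) f;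
  ccomp1l : forall X Y (f : chom X Y), ccomp (cid Y) f = f;
  ccomp1r : forall X Y (f : chom X Y), ccomp f (cid X) = f }.
Arguments chom {c}.
Arguments cid {c}.
Arguments ccomp {c X Y Z}.

Notation "g \oc f" := (ccomp g f) (at level 50, left associativity) : tensor_scope.

(* Equality of arrows whose sources and targets are equal, but possibly not
   convertible: equality in the class of all arrows of the category. *)
Inductive arrow_eq (C : category) (X Y : C) (f : chom X Y) :
    forall X' Y' : C, chom X' Y' -> Prop :=
| ArrowEq : arrow_eq f f.

Notation "f =~ g" := (arrow_eq f g) (at level 70, no associativity) : tensor_scope.

Definition is_iso (C : category) (X Y : C) (f : chom X Y) : Prop :=
  exists g : chom Y X, g \oc f = cid X /\ f \oc g = cid Y.

Record monoidalData (C : category) := MonoidalData {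
  mtens : C -> C -> C;
  mtensm : forall X X' Y Y' : C,
    chom X X' -> chom Y Y' -> chom (mtens X Y) (mtens X' Y');
  munit : C;
  massoc : forall X Y Z, chom (mtens (mtens X Y) Z) (mtens X (mtens Y Z));
  massocV : forall X Y Z, chom (mtens X (mtens Y Z)) (mtens (mtens X Y) Z);
  mlunit : forall X, chom (mtens munit X) X;
  mrunit : forall X, chom (mtens X munit) X }.
Arguments mtens {C} m X Y.
Arguments mtensm {C} m {X X' Y Y'}.
Arguments massoc {C} m X Y Z.
Arguments massocV {C} m X Y Z.
Arguments mlunit {C} m X.
Arguments mrunit {C} m X.

Section Monoidal.
Variables (C : category) (T : monoidalData C).
Local Notation "X *o Y" := (mtens T X Y) (at level 40, left associativity).
Local Notation "f *m g" := (mtensm T f g) (at level 40, left associativity).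

Record is_monoidal : Prop := IsMonoidal {
  mtensm_id : forall X Y : C, cid X *m cid Y = cid (X *o Y);
  mtensm_comp : forall X X' X'' Y Y' Y'' : C,
    forall (f' : chom X' X'') (f : chom X X') (g' : chom Y' Y'') (g : chom Y Y'),
    (f' \oc f) *m (g' \oc g) = (f' *m g') \oc (f *m g);
  massocK : forall X Y Z : C, massocV T X Y Z \oc massoc T X Y Z = cid _;
  massocVK : forall X Y Z : C, massoc T X Y Z \oc massocV T X Y Z = cid _;
  massoc_nat : forall X X' Y Y' Z Z' : C,
    forall (f : chom X X') (g : chom Y Y') (h : chom Z Z'),
    massoc T X' Y' Z' \oc ((f *m g) *m h) = (f *m (g *m h)) \oc massoc T X Y Z;
  mlunit_iso : forall X : C, is_iso (mlunit T X);
  mlunit_nat : forall (X X' : C) (f : chom X X'),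
    mlunit T X' \oc (cid (munit T) *m f) = f \oc mlunit T X;
  mrunit_iso : forall X : C, is_iso (mrunit T X);
  mrunit_nat : forall (X X' : C) (f : chom X X'),
    mrunit T X' \oc (f *m cid (munit T)) = f \oc mrunit T X;
  mpentagon : forall W X Y Z : C,
    massoc T W X (Y *o Z) \oc massoc T (W *o X) Y Z
    = (cid W *m massoc T X Y Z) \oc massoc T W (X *o Y) Z
        \oc (massoc T W X Y *m cid Z);
  mtriangle : forall X Y : C,
    (cid X *m mlunit T Y) \oc massoc T X (munit T) Y = mrunit T X *m cid Y }.

End Monoidal.

(* [cdeg X] is the index of the subcategory that contains X; [cphi b] and
   [cphim b] are the effect of the functor phi_b on objects and on arrows. *)
Record crossedData (G : groupType) (C : category) := CrossedData {
  cdeg : C -> G;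
  cphi : G -> C -> C;
  cphim : forall (b : G) (X Y : C), chom X Y -> chom (cphi b X) (cphi b Y) }.
Arguments cdeg {G C} c.
Arguments cphi {G C} c.
Arguments cphim {G C} c b {X Y}.

Section Crossed.
Variables (G : groupType) (C : category).
Variables (T : monoidalData C) (P : crossedData G C).
Local Notation "X *o Y" := (mtens T X Y) (at level 40, left associativity).
Local Notation "f *m g" := (mtensm T f g) (at level 40, left associativity).
Local Notation phi := (cphi P).
Local Notation phim := (cphim P).
Local Notation deg := (cdeg P).

Record is_strict_tensor_functor (b : G) : Prop := IsStrictTensorFunctor {
  cphim_id : forall X : C, phim b (cid X) = cid (phi b X);
  cphim_comp : forall (X Y Z : C) (g : chom Y Z) (f : chom X Y),
    phim b (g \oc f) = phim b g \oc phim b f;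
  cphi_tens : forall X Y : C, phi b (X *o Y) = phi b X *o phi b Y;
  cphi_unit : phi b (munit T) = munit T;
  cphim_tens : forall (X X' Y Y' : C) (f : chom X X') (g : chom Y Y'),
    phim b (f *m g) =~ phim b f *m phim b g;
  cphim_assoc : forall X Y Z : C,
    phim b (massoc T X Y Z) =~ massoc T (phi b X) (phi b Y) (phi b Z);
  cphim_lunit : forall X : C, phim b (mlunit T X) =~ mlunit T (phi b X);
  cphim_runit : forall X : C, phim b (mrunit T X) =~ mrunit T (phi b X) }.

(* [cphi_one] to [cphim_mul] say that b |-> phi_b is a group homomorphism;
   phi_b is then invertible, with inverse phi_(b^-1). *)
Record is_crossed : Prop := IsCrossed {
  crossed_monoidal : is_monoidal T;
  cdeg_disjoint : forall (X Y : C), chom X Y -> deg X = deg Y;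
  cdeg_tens : forall X Y : C, deg (X *o Y) = (deg X * deg Y)%g;
  cphi_functor : forall b : G, is_strict_tensor_functor b;
  cphi_one : forall X : C, phi 1%g X = X;
  cphim_one : forall (X Y : C) (f : chom X Y), phim 1%g f =~ f;
  cphi_mul : forall (a b : G) (X : C), phi (a * b)%g X = phi a (phi b X);
  cphim_mul : forall (a b : G) (X Y : C) (f : chom X Y),
    phim (a * b)%g f =~ phim a (phim b f);
  cphi_deg : forall (a b : G) (V : C),
    deg V = (b * a * b^-1)%g <-> exists2 U, deg U = a & phi b U = V }.

Definition braidingData :=
  forall U V : C, chom (U *o V) (phi (deg U) V *o U).

Record is_braiding (c : braidingData) : Prop := IsBraiding {
  braid_iso : forall U V : C, is_iso (c U V);
  braid_nat : forall (U U' V V' : C) (f : chom U U') (g : chom V V'),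
    (phim (deg U) g *m f) \oc c U V =~ c U' V' \oc (f *m g);
  braid_tensl : forall U V W : C,
    c (U *o V) W =~
      massoc T (phi (deg U) (phi (deg V) W)) U V
        \oc (c U (phi (deg V) W) *m cid V)
        \oc massocV T U (phi (deg V) W) V
        \oc (cid U *m c V W)
        \oc massoc T U V W;
  braid_tensr : forall U V W : C,
    c U (V *o W) =~
      massocV T (phi (deg U) V) (phi (deg U) W) U
        \oc (cid (phi (deg U) V) *m c U W)
        \oc massoc T (phi (deg U) V) U W
        \oc (c U V *m cid W)
        \oc massocV T U V W;
  braid_phi : forall (b : G) (U V : C),
    phim b (c U V) =~ c (phi b U) (phi b V) }.

Definition is_braided_T_category (c : braidingData) : Prop :=
  is_crossed /\ is_braiding c.

End Crossed.

Section ZMHYD.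
Variables (K : fieldType) (H : homHopf K).

Fact zcompA (W X Y Z : zobj H) (h : zmor Y Z) (g : zmor X Y) (f : zmor W X) :
  zcomp h (zcomp g f) = zcomp (zcomp h g) f.
Proof. exact: zmor_eq. Qed.

Fact zcomp1l (X Y : zobj H) (f : zmor X Y) : zcomp (zid Y) f = f.
Proof. exact: zmor_eq. Qed.

Fact zcomp1r (X Y : zobj H) (f : zmor X Y) : zcomp f (zid X) = f.
Proof. exact: zmor_eq. Qed.

Definition ZMHYD : category := Category zcompA zcomp1l zcomp1r.

(* The structure maps are given by the formulas above; that they yield objects
   and morphisms of ZMHYD is the content of the two records below, which the
   structure on ZMHYD takes as parameters. *)
Record zmhyd_objects : Prop := ZmhydObjects {
  ztens_yd : forall M N : zobj H, is_yd (zdeg M + zdeg N) (yd_tens (zdeg N) M N);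
  zunit_yd : is_yd 0 (yd_unit H);
  zconj_yd : forall (m : int) (N : zobj H), is_yd (zdeg N) (yd_conj m N) }.

Section Objects.
Hypothesis w : zmhyd_objects.

Definition ztens (M N : zobj H) : zobj H := ZObj (ztens_yd w M N).
Definition zunit : zobj H := ZObj (zunit_yd w).
Definition zconj (m : int) (N : zobj H) : zobj H := ZObj (zconj_yd w m N).

Record zmhyd_morphisms : Prop := ZmhydMorphisms {
  ztens_mor : forall (M M' N N' : zobj H) (f : zmor M M') (g : zmor N N'),
    @is_zmor K H (ztens M N) (ztens M' N') (tmap f g);
  zassoc_mor : forall L M N : zobj H,
    @is_zmor K H (ztens (ztens L M) N) (ztens L (ztens M N)) (@hassoc K L M N);
  zassocV_mor : forall L M N : zobj H,
    @is_zmor K H (ztens L (ztens M N)) (ztens (ztens L M) N) (@hassocV K L M N);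
  zlunit_mor : forall M : zobj H,
    @is_zmor K H (ztens zunit M) M (@hlunit K M);
  zrunit_mor : forall M : zobj H,
    @is_zmor K H (ztens M zunit) M (@hrunit K M);
  zconj_mor : forall (m : int) (M N : zobj H) (f : zmor M N),
    @is_zmor K H (zconj m M) (zconj m N) f;
  zbraid_mor : forall M N : zobj H,
    @is_zmor K H (ztens M N) (ztens (zconj (zdeg M) N) M) (@yd_braid K H M N) }.

Hypothesis w' : zmhyd_morphisms.

Definition zmhyd_monoidal : monoidalData ZMHYD :=
  @MonoidalData ZMHYD ztens
    (fun M M' N N' f g => ZMor (ztens_mor w' f g))
    zunit
    (fun L M N => ZMor (zassoc_mor w' L M N))
    (fun L M N => ZMor (zassocV_mor w' L M N))
    (fun M => ZMor (zlunit_mor w' M))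
    (fun M => ZMor (zrunit_mor w' M)).

(* [Algebra.to_multiplicative int] is the additive group of the integers. *)
Definition zmhyd_crossed : crossedData (Algebra.to_multiplicative int) ZMHYD :=
  @CrossedData (Algebra.to_multiplicative int) ZMHYD (@zdeg K H) zconj
    (fun m M N f => ZMor (zconj_mor w' m f)).

Definition zmhyd_braiding : braidingData zmhyd_monoidal zmhyd_crossed :=
  fun M N => ZMor (zbraid_mor w' M N).

End Objects.
End ZMHYD.

(* Main.v *)
Require Import Defs.
From mathcomp Require Import all_boot all_algebra.
From mathcomp Require Import boolp.

Set Implicit Arguments.
Unset Strict Implicit.
Unset Printing Implicit Defensive.
Import GRing.Theory.
Local Open Scope ring_scope.
Local Open Scope tensor_scope.

(** Write xi for the structure automorphisms and put s = S^(2n).  The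
    compatibility condition of an n-Yetter-Drinfeld Hom-module mentions the odd
    power S^(2n-1), which reverses products and coproducts.  Multiplying by
    s(h_1) and cancelling the antipode turns it into the equivalent exchange
    identity ([yd_exchangeP], [yd_of_exchange])

      h_1.m_0 ⊗ h_2 m_1 = xi((h_2.xi^-1 m)_0) ⊗ (h_2.xi^-1 m)_1 s(h_1),

    in which only s occurs.  Since S reverses products and coproducts ([S_mul],
    [S_delta]), S^2 and hence s are automorphisms of the whole structure of H
    ([hopf_end_Spow]); so s passes freely through products, coproducts and xi,
    and the statement becomes a series of short Sweedler computations.

    The exchange identities of M and N combine to that of M ⊗ N, because
    h.(x ⊗ y) = S^(2n)(h_1).x ⊗ h_2.y applies to x exactly the power of S that
    the identity of N leaves behind ([tens_exchange]).  For the braiding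
    x ⊗ y |-> xi(y_0) ⊗ y_1.xi^-1(x), H-linearity is the exchange identity of N
    and H-colinearity is that of M ([braid_hom]); its inverse is
    y ⊗ x |-> S(y_1).xi^-1(x) ⊗ xi(y_0) ([braidK], [braidVK]).  The first hexagon
    is coassociativity of the coaction of W, the second is associativity of the
    action on U ([hexagon_l], [hexagon_r]).  Conjugation by b twists actions by
    S^(-2b) and coactions by S^(2b), which are automorphisms, and in the braiding
    the two twists meet and cancel ([braid_conj]).

    That S reverses products and coproducts is proved for ordinary Hopf algebras,
    by uniqueness of convolution inverses, and then transported: the operations
    xi^-1(ab) and (xi ⊗ xi)Delta turn H into an ordinary Hopf algebra with the
    same antipode.

    Coassociativity is always used after applying a trilinear map to it: two
    iterated Sweedler sums of this map agree up to powers of xi ([coassocL],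
    [coassocR], [coact_coassocL], [coact_coassocR]). *)

(** * Multilinear maps and Sweedler sums *)

(** Linearity as a predicate with a single head symbol and no nested structure,
    so that proof search can match on it; [lin_linear] relates it to [linear]. *)
Definition lin (K : fieldType) (U V : lmodType K) (f : U -> V) : Prop :=
  forall a u v, f (a *: u + v) = a *: f u + f v.

Section Sums.
Variable K : fieldType.
Implicit Types U V W M N : lmodType K.

Lemma lin_linear U V (f : U -> V) : linear f <-> lin f.
Proof. by []. Qed.

Lemma lin_id U : lin (fun x : U => x).
Proof. by []. Qed.

Lemma lin_comp U V W (g : V -> W) (f : U -> V) :
  lin g -> lin f -> lin (fun x => g (f x)).
Proof. by move=> gl fl a u v; rewrite fl gl. Qed.

Lemma lin_scale U V (c : K) (f : U -> V) : lin f -> lin (fun x => c *: f x).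
Proof. by move=> fl a u v; rewrite fl scalerDr !scalerA mulrC. Qed.

Lemma lin_scalel U V (v : V) (f : U -> K^o) : lin f -> lin (fun x => (f x : K) *: v).
Proof. by move=> fl a x y; rewrite fl scalerDl scalerA. Qed.

Lemma lin_bilinl M N V U (f : M -> N -> V) n (g : U -> M) :
  bilin f -> lin g -> lin (fun x => f (g x) n).
Proof. by move=> [fl _] gl a u v; rewrite gl fl. Qed.

Lemma bilinP M N V (f : M -> N -> V) :
  (forall n, lin (fun m => f m n)) -> (forall m, lin (fun n => f m n)) -> bilin f.
Proof. by []. Qed.

Lemma lin_tsum M N V (f : M -> N -> V) : bilin f -> lin (fun t => tsum f t).
Proof. exact: tsum_linear. Qed.

Lemma lin_tsum_arg U M N V (f : M -> N -> V) (g : U -> tensor M N) :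
  bilin f -> lin g -> lin (fun x => tsum f (g x)).
Proof. by move=> fb; apply: lin_comp; exact: lin_tsum. Qed.

Lemma lin_tsum_body U M N V (f : U -> M -> N -> V) t :
  (forall m n, lin (fun x => f x m n)) -> lin (fun x => tsum (f x) t).
Proof.
move=> fl a u v; rewrite /tsum scaler_sumr -big_split /=.
by apply: eq_bigr => p _; rewrite fl.
Qed.

Lemma eq_tsum M N (V : zmodType) (f g : M -> N -> V) t :
  (forall m n, f m n = g m n) -> tsum f t = tsum g t.
Proof. by move=> fg; apply: eq_bigr => p _. Qed.

Lemma lin_sum U V (f : U -> V) (I : Type) (r : seq I) (F : I -> U) :
  lin f -> f (\sum_(i <- r) F i) = \sum_(i <- r) f (F i).
Proof.
move=> fl; elim/big_rec2: _ => [|i y x _ <-].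
  by have := fl (-1) 0 0; rewrite scaler0 addr0 scaleN1r addNr.
by rewrite -[F i]scale1r fl !scale1r.
Qed.

Lemma lin_scaleE U V (f : U -> V) c v : lin f -> f (c *: v) = c *: f v.
Proof.
move=> fl; have f0 : f 0 = 0.
  by have := fl (-1) 0 0; rewrite scaler0 addr0 scaleN1r addNr.
by rewrite -[c *: v]addr0 fl f0 addr0.
Qed.

Lemma lin_tsumE U V M N (f : U -> V) (g : M -> N -> U) t :
  lin f -> f (tsum g t) = tsum (fun m n => f (g m n)) t.
Proof. exact: lin_sum. Qed.

Lemma scale_tsum M N V (c : K) (g : M -> N -> V) t :
  c *: tsum g t = \Sw_(m, n <- t) c *: g m n.
Proof. exact: scaler_sumr. Qed.

Lemma lin_of_bilin M N V (f : M -> N -> V) m : bilin f -> lin (f m).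
Proof. by move=> [_ fr]; exact: fr. Qed.

Lemma lin_of_linear U V (f : {linear U -> V}) : lin f.
Proof. by move=> a u v; rewrite linearP. Qed.

Section BilinE.
Variables (M N V : lmodType K) (f : M -> N -> V).
Hypothesis fb : bilin f.

Lemma bilinZl c m n : f (c *: m) n = c *: f m n.
Proof. by apply: (lin_scaleE (f := f^~ n)) => a u v; rewrite (proj1 fb). Qed.

Lemma bilinZr c m n : f m (c *: n) = c *: f m n.
Proof. by apply: lin_scaleE => a u v; rewrite (proj2 fb). Qed.

Lemma bilin_tsuml M' N' (g : M' -> N' -> M) t n :
  f (tsum g t) n = \Sw_(x, y <- t) f (g x y) n.
Proof. by apply: (lin_tsumE (f := f^~ n)) => a u v; rewrite (proj1 fb). Qed.

Lemma bilin_tsumr M' N' (g : M' -> N' -> N) t m :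
  f m (tsum g t) = \Sw_(x, y <- t) f m (g x y).
Proof. by apply: lin_tsumE => a u v; rewrite (proj2 fb). Qed.

End BilinE.

Lemma tpure_suml M N M' N' (g : M' -> N' -> M) t (n : N) :
  (tsum g t) ⊗ n = \Sw_(x, y <- t) g x y ⊗ n.
Proof. exact: (bilin_tsuml (@tpure_bilin _ _ _)). Qed.

Lemma tpure_sumr M N M' N' (g : M' -> N' -> N) t (m : M) :
  m ⊗ (tsum g t) = \Sw_(x, y <- t) m ⊗ g x y.
Proof. exact: (bilin_tsumr (@tpure_bilin _ _ _)). Qed.

Lemma tpureZl M N (c : K) (m : M) (n : N) : (c *: m) ⊗ n = c *: (m ⊗ n).
Proof. exact: (bilinZl (@tpure_bilin _ _ _)). Qed.

Lemma tpureZr M N (c : K) (m : M) (n : N) : m ⊗ (c *: n) = c *: (m ⊗ n).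
Proof. exact: (bilinZr (@tpure_bilin _ _ _)). Qed.

(** Only the outer map has to be bilinear: a Sweedler sum is a finite sum over
    one chosen decomposition, so it can be pulled out of any linear map. *)
Lemma tsum_tsum M N M' N' V (f : M' -> N' -> V) (g : M -> N -> tensor M' N') t :
  bilin f -> tsum f (tsum g t) = \Sw_(m, n <- t) tsum f (g m n).
Proof. by move=> fb; apply: lin_tsumE; exact: lin_tsum. Qed.

Lemma tsum_exchange M N M' N' V (f : M -> N -> M' -> N' -> V) t u :
  \Sw_(m, n <- t) \Sw_(m', n' <- u) f m n m' n' =
  \Sw_(m', n' <- u) \Sw_(m, n <- t) f m n m' n'.
Proof. by rewrite /tsum exchange_big. Qed.

Lemma tsum_tpure M N (t : tensor M N) : tsum (@tpure K M N) t = t.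
Proof. exact/esym/tensor_decomp. Qed.

Lemma tmap_pure M M' N N' (f : M -> M') (g : N -> N') x y :
  lin f -> lin g -> tmap f g (x ⊗ y) = f x ⊗ g y.
Proof. exact: tmapE. Qed.

Lemma tensor_ext M N V (f g : tensor M N -> V) : lin f -> lin g ->
  (forall m n, f (m ⊗ n) = g (m ⊗ n)) -> f =1 g.
Proof.
by move=> fl gl fg t; rewrite (tensor_decomp t) !lin_sum //; apply: eq_bigr.
Qed.

Lemma tensor3_ext L M N V (f g : tensor (tensor L M) N -> V) : lin f -> lin g ->
  (forall l m n, f ((l ⊗ m) ⊗ n) = g ((l ⊗ m) ⊗ n)) -> f =1 g.
Proof.
move=> fl gl fg; apply: tensor_ext => // u n; move: u.
have pb := @tpure_bilin K (tensor L M) N.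
apply: (@tensor_ext _ _ _ (fun u => f (u ⊗ n)) (fun u => g (u ⊗ n))) => //.
- by apply: lin_comp => // a x y; rewrite (proj1 pb).
- by apply: lin_comp => // a x y; rewrite (proj1 pb).
Qed.

Lemma tensor4_ext L M N P V (f g : tensor (tensor (tensor L M) N) P -> V) :
  lin f -> lin g ->
  (forall l m n p, f (((l ⊗ m) ⊗ n) ⊗ p) = g (((l ⊗ m) ⊗ n) ⊗ p)) -> f =1 g.
Proof.
move=> fl gl fg; apply: tensor_ext => // u p; move: u.
have pb := @tpure_bilin K (tensor (tensor L M) N) P.
apply: (@tensor3_ext _ _ _ _ (fun u => f (u ⊗ p)) (fun u => g (u ⊗ p))) => //.
- by apply: lin_comp => // a x y; rewrite (proj1 pb).
- by apply: lin_comp => // a x y; rewrite (proj1 pb).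
Qed.

Lemma tensor3_extr L M N V (f g : tensor L (tensor M N) -> V) : lin f -> lin g ->
  (forall l m n, f (l ⊗ (m ⊗ n)) = g (l ⊗ (m ⊗ n))) -> f =1 g.
Proof.
move=> fl gl fg; apply: tensor_ext => // l u; move: u.
have pb := @tpure_bilin K L (tensor M N).
apply: (@tensor_ext _ _ _ (fun u => f (l ⊗ u)) (fun u => g (l ⊗ u))) => //.
- by apply: lin_comp => // a x y; rewrite (proj2 pb).
- by apply: lin_comp => // a x y; rewrite (proj2 pb).
Qed.

End Sums.

Definition trilin (K : fieldType) (U V W X : lmodType K) (f : U -> V -> W -> X) : Prop :=
  (forall v w, lin (fun u => f u v w)) /\ (forall u, bilin (f u)).

Create HintDb lin discriminated.

#[export] Hint Resolve tpure_bilin lin_of_bilin lin_of_linear : lin.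

(** Multilinearity of a named operation, from the hint database. *)
Ltac lin_known := solve [eauto 6 with lin nocore].

(** In a Sweedler expression each variable occurs exactly once, so linearity in
    it is proved by following that occurrence down the term: each step peels off
    one operation that is linear in the argument containing the variable.  The
    match is not lazy because a metavariable of a pattern may capture the bound
    variable; such a branch fails when its lemma is applied. *)
Ltac lin :=
  match goal with
  | |- forall _, _ => intro; lin
  | |- trilin _ => split; cbv beta; lin
  | |- bilin _ => first [lin_known | apply: bilinP; lin]
  | |- lin (fun x => x) => exact: lin_id
  | |- lin (fun x => tsum _ _) =>
      first [apply: lin_tsum_arg; lin | apply: lin_tsum_body; cbv beta; lin]
  | |- lin (fun x => ?c *: (@?f x)) =>
      first [apply: (lin_scale c (f := f)) | apply: lin_scale]; lin
  | |- lin (fun x => (@?f x) *: ?v) =>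
      first [apply: (lin_scalel v (f := f)) | apply: lin_scalel]; lin
  | |- lin (fun x => ?g (@?f x)) =>
      first [lin_known | apply: (lin_comp (g := g) (f := f)); [lin_known | lin]]
  | |- lin (fun x => ?g (@?f x) ?n) =>
      apply: (lin_bilinl (f := g) n (g := f)); [lin_known | lin]
  | |- lin (fun x => ?g (@?f x) ?n ?p) =>
      apply: (lin_comp (g := fun y => g y n p) (f := f)); [lin_known | lin]
  | |- _ => lin_known
  | |- lin _ => exact: lin_of_linear
  end.

(** Normal form of an iterated Sweedler sum: the rules [r] rewrite at each level
    outside the remaining binders, sums over sums are merged, sums over pure
    tensors are evaluated, and the rest is opened with [eq_tsum].  The result is a
    nest of sums over unstructured (co)products with a sum-free body. *)
Ltac sw_simp r :=
  rewrite ?r; cbv beta;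
  lazymatch goal with
  | |- tsum ?F (tsum ?G ?u) = _ =>
      etransitivity; [apply: (tsum_tsum (f := F) G u); lin | cbv beta; sw_simp r]
  | |- tsum ?F (tpure ?a ?b) = _ =>
      etransitivity; [apply: (tsumE (f := F) _ a b); lin | cbv beta; sw_simp r]
  | |- tsum ?F ?u = _ =>
      apply: eq_tsum;
      let a := fresh "a" in let b := fresh "b" in intros a b; cbv beta; sw_simp r
  | |- _ => reflexivity
  end.

Ltac sw r :=
  etransitivity; [sw_simp r | symmetry; etransitivity; [sw_simp r | symmetry]].
Ltac swl r := etransitivity; [sw_simp r |].
Ltac swr r := symmetry; swl r; symmetry.

(** * Ordinary Hopf algebras and their antipode *)

Section OrdinaryHopf.
Variables (K : fieldType) (C : lmodType K).
Variables (D : C -> tensor C C) (e : C -> K^o).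

Record is_coalg : Prop := IsCoalg {
  coalg_lin : lin D;
  coalg_elin : lin e;
  coalgA : forall c, \Sw_(c1, c2 <- D c) \Sw_(c21, c22 <- D c2) c1 ⊗ (c21 ⊗ c22)
    = \Sw_(c1, c2 <- D c) \Sw_(c11, c12 <- D c1) c11 ⊗ (c12 ⊗ c2);
  coalg_er : forall c, \Sw_(c1, c2 <- D c) (e c2 : K) *: c1 = c;
  coalg_el : forall c, \Sw_(c1, c2 <- D c) (e c1 : K) *: c2 = c }.

Lemma tsum3_linear (U V W X : lmodType K) (f : U -> V -> W -> X) :
  trilin f -> bilin (fun u t => tsum (f u) t).
Proof. by move=> [f1 f2]; lin. Qed.

Lemma coalgA_f (V : lmodType K) (f : C -> C -> C -> V) c : is_coalg -> trilin f ->
  \Sw_(c1, c2 <- D c) \Sw_(c21, c22 <- D c2) f c1 c21 c22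
    = \Sw_(c1, c2 <- D c) \Sw_(c11, c12 <- D c1) f c11 c12 c2.
Proof.
move=> cC ft; have fb := tsum3_linear ft; have [f1 f2] := ft.
have := congr1 (tsum (fun x t => tsum (f x) t)) (coalgA cC c).
rewrite !tsum_tsum // => E; apply: etrans (etrans E _).
  apply: eq_tsum => x y; rewrite tsum_tsum //; apply: eq_tsum => a b.
  by rewrite tsumE // tsumE.
apply: eq_tsum => x y; rewrite tsum_tsum //; apply: eq_tsum => a b.
by rewrite tsumE // tsumE.
Qed.

Variables (A : lmodType K) (mul : A -> A -> A) (one : A).
Record is_alg : Prop := IsAlg {
  alg_bilin : bilin mul;
  algA : forall a b c, mul a (mul b c) = mul (mul a b) c;
  alg1l : forall a, mul one a = a;
  alg1r : forall a, mul a one = a }.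

End OrdinaryHopf.

Section Conv.
Variables (K : fieldType) (C A : lmodType K).
Variables (D : C -> tensor C C) (e : C -> K^o) (mul : A -> A -> A) (one : A).
Hypotheses (cC : is_coalg D e) (aA : is_alg mul one).
Let mulb : bilin mul := alg_bilin aA.
Let Dl : lin D := coalg_lin cC.
Let el : lin e := coalg_elin cC.

(** Uniqueness of convolution inverses: P = P * (F * Q) = (P * F) * Q = Q. *)
Lemma conv_unique (P F Q : C -> A) : lin P -> lin F -> lin Q ->
  (forall c, \Sw_(c1, c2 <- D c) mul (P c1) (F c2) = (e c : K) *: one) ->
  (forall c, \Sw_(c1, c2 <- D c) mul (F c1) (Q c2) = (e c : K) *: one) ->
  P =1 Q.
Proof.
move=> Pl Fl Ql PF FQ c.
transitivity (\Sw_(c1, c2 <- D c) \Sw_(c21, c22 <- D c2) mul (P c1) (mul (F c21) (Q c22))).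
  rewrite -[LHS](congr1 P (coalg_er cC c)) (lin_tsumE _ _ Pl).
  apply: eq_tsum => x y; rewrite -(bilin_tsumr mulb) FQ.
  by rewrite (bilinZr mulb) (alg1r aA) (lin_scaleE _ _ Pl).
rewrite (coalgA_f _ cC (f := fun a b c => mul (P a) (mul (F b) (Q c)))); last by lin.
rewrite -[RHS](congr1 Q (coalg_el cC c)) (lin_tsumE _ _ Ql).
apply: eq_tsum => x y.
transitivity (mul (\Sw_(c11, c12 <- D x) mul (P c11) (F c12)) (Q y)).
  by rewrite (bilin_tsuml mulb); apply: eq_tsum => a b; rewrite (algA aA).
by rewrite PF (bilinZl mulb) (alg1l aA) (lin_scaleE _ _ Ql).
Qed.

(** The same argument over the coalgebra C ⊗ C, written with bilinear maps so
    that its coalgebra structure need not be set up. *)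
Lemma conv_unique2 (P F Q : C -> C -> A) : bilin P -> bilin F -> bilin Q ->
  (forall a b, \Sw_(a1, a2 <- D a) \Sw_(b1, b2 <- D b) mul (P a1 b1) (F a2 b2)
     = (e a : K) *: ((e b : K) *: one)) ->
  (forall a b, \Sw_(a1, a2 <- D a) \Sw_(b1, b2 <- D b) mul (F a1 b1) (Q a2 b2)
     = (e a : K) *: ((e b : K) *: one)) ->
  forall a b, P a b = Q a b.
Proof.
move=> Pb Fb Qb PF FQ a b.
transitivity (\Sw_(a1, a2 <- D a) \Sw_(a21, a22 <- D a2)
  \Sw_(b1, b2 <- D b) \Sw_(b21, b22 <- D b2)
    mul (P a1 b1) (mul (F a21 b21) (Q a22 b22))).
  rewrite -[in LHS](coalg_er cC a) (bilin_tsuml Pb).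
  apply: eq_tsum => x y; rewrite -[in LHS](coalg_er cC b) (bilin_tsumr Pb).
  rewrite [RHS]tsum_exchange; apply: eq_tsum => z t.
  rewrite (bilinZl Pb) (bilinZr Pb).
  transitivity (mul (P x z) (\Sw_(y1, y2 <- D y) \Sw_(t1, t2 <- D t)
     mul (F y1 t1) (Q y2 t2))).
    by rewrite FQ !(bilinZr mulb) (alg1r aA).
  by rewrite (bilin_tsumr mulb); apply: eq_tsum => u v; rewrite (bilin_tsumr mulb).
rewrite (coalgA_f _ cC (f := fun a1 a2 a3 => \Sw_(b1, b2 <- D b) \Sw_(b21, b22 <- D b2)
    mul (P a1 b1) (mul (F a2 b21) (Q a3 b22)))); last by lin.
rewrite -[in RHS](coalg_el cC a) (bilin_tsuml Qb).
apply: eq_tsum => x y.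
transitivity (\Sw_(x1, x2 <- D x) \Sw_(b1, b2 <- D b) \Sw_(b11, b12 <- D b1)
   mul (mul (P x1 b11) (F x2 b12)) (Q y b2)).
  apply: eq_tsum => x1 x2.
  rewrite (coalgA_f _ cC (f := fun b1 b2 b3 =>
    mul (P x1 b1) (mul (F x2 b2) (Q y b3)))); last by lin.
  by apply: eq_tsum => b1 b2; apply: eq_tsum => b11 b12; rewrite (algA aA).
rewrite tsum_exchange -[in RHS](coalg_el cC b) (bilin_tsumr Qb).
apply: eq_tsum => z t.
transitivity (mul (\Sw_(x1, x2 <- D x) \Sw_(z1, z2 <- D z) mul (P x1 z1) (F x2 z2)) (Q y t)).
  rewrite (bilin_tsuml mulb); apply: eq_tsum => x1 x2.
  by rewrite (bilin_tsuml mulb).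
by rewrite PF !(bilinZl mulb) (alg1l aA) (bilinZl Qb) (bilinZr Qb).
Qed.
End Conv.

(** The componentwise product of A ⊗ A, the target algebra in which the
    coproduct is convolution invertible. *)
Definition tmul (K : fieldType) (A : lmodType K) (mul : A -> A -> A)
    (t u : tensor A A) : tensor A A :=
  \Sw_(a, b <- t) \Sw_(c, d <- u) mul a c ⊗ mul b d.

Lemma tmul_alg (K : fieldType) (A : lmodType K) (mul : A -> A -> A) one :
  is_alg mul one -> is_alg (tmul mul) (one ⊗ one).
Proof.
move=> [mb mA m1 m1r].
have tb : bilin (tmul mul) by rewrite /tmul; lin.
have tE a b c d : tmul mul (a ⊗ b) (c ⊗ d) = mul a c ⊗ mul b d.
  by rewrite /tmul tsumE ?tsumE //; lin.
split=> // [t u v|t|t].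
- move: t; apply: tensor_ext; [by lin|by lin|move=> a b].
  move: u; apply: tensor_ext; [by lin|by lin|move=> c d].
  move: v; apply: tensor_ext; [by lin|by lin|move=> x y].
  by rewrite !tE !mA.
- by move: t; apply: tensor_ext; [by lin|by lin|move=> a b]; rewrite tE !m1.
- by move: t; apply: tensor_ext; [by lin|by lin|move=> a b]; rewrite tE !m1r.
Qed.

Section Hopf.
Variables (K : fieldType) (A : lmodType K) (mul : A -> A -> A) (one : A).
Variables (D : A -> tensor A A) (e : A -> K^o) (S : A -> A).
Hypotheses (aA : is_alg mul one) (cA : is_coalg D e) (Sl : lin S).
Hypothesis DM : forall a b, D (mul a b) =
  \Sw_(a1, a2 <- D a) \Sw_(b1, b2 <- D b) mul a1 b1 ⊗ mul a2 b2.
Hypothesis D1 : D one = one ⊗ one.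
Hypothesis eM : forall a b, e (mul a b) = (e a : K) * (e b : K).
Hypothesis Sleft : forall h, \Sw_(h1, h2 <- D h) mul (S h1) h2 = (e h : K) *: one.
Hypothesis Sright : forall h, \Sw_(h1, h2 <- D h) mul h1 (S h2) = (e h : K) *: one.
Let mb : bilin mul := alg_bilin aA.
Let Dl : lin D := coalg_lin cA.
Let el : lin e := coalg_elin cA.

(** Both sides are convolution inverse to the product of A on A ⊗ A. *)
Lemma antipode_mul a b : S (mul a b) = mul (S b) (S a).
Proof.
apply: (conv_unique2 cA aA (P := fun a b => S (mul a b)) (F := mul)
  (Q := fun a b => mul (S b) (S a))); [by lin|by lin|by lin| |] => {}a {}b.
  rewrite scalerA -eM -Sleft DM tsum_tsum; last by lin.
  apply: eq_tsum => a1 a2; rewrite tsum_tsum; last by lin.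
  by apply: eq_tsum => b1 b2; rewrite tsumE; last by lin.
rewrite scalerA mulrC -scalerA -Sright scale_tsum.
apply: eq_tsum => a1 a2.
transitivity (mul a1 (mul (\Sw_(b1, b2 <- D b) mul b1 (S b2)) (S a2))).
  rewrite (bilin_tsuml mb) (bilin_tsumr mb).
  by apply: eq_tsum => b1 b2; rewrite !(algA aA).
by rewrite Sright (bilinZl mb) (bilinZr mb) (alg1l aA).
Qed.

(** Both sides are convolution inverse to the coproduct in A ⊗ A. *)
Lemma antipode_delta h : D (S h) = \Sw_(h1, h2 <- D h) S h2 ⊗ S h1.
Proof.
have aT := tmul_alg aA; have tb : bilin (tmul mul) := alg_bilin aT.
have tE a b c d : tmul mul (a ⊗ b) (c ⊗ d) = mul a c ⊗ mul b d.
  by rewrite /tmul tsumE ?tsumE //; lin.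
have DM' a b : D (mul a b) = tmul mul (D a) (D b) by rewrite DM.
move: h; apply: (conv_unique cA aT (P := fun h => D (S h)) (F := D)
  (Q := fun h => \Sw_(h1, h2 <- D h) S h2 ⊗ S h1)); [by lin|by lin|by lin| |] => h.
  rewrite -D1 -(lin_scaleE _ _ Dl) -Sleft (lin_tsumE _ _ Dl).
  by apply: eq_tsum => a b; rewrite DM'.
(* In h_1 S(h_4) ⊗ h_2 S(h_3) the inner pair cancels first, then the outer one. *)
pose f a b c := \Sw_(a1, a2 <- D a) mul a1 (S c) ⊗ mul a2 (S b).
transitivity (\Sw_(h1, h2 <- D h) \Sw_(h21, h22 <- D h2) f h1 h21 h22).
  apply: eq_tsum => a b; rewrite (bilin_tsumr tb); apply: eq_tsum => c d.
  rewrite -[X in tmul _ X _]tsum_tpure (bilin_tsuml tb).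
  by apply: eq_tsum => x y; rewrite tE.
rewrite (coalgA_f _ cA (f := f)); last by rewrite /f; lin.
transitivity (\Sw_(h1, h2 <- D h) mul h1 (S h2) ⊗ one); last first.
  by rewrite -tpureZl -Sright tpure_suml.
apply: eq_tsum => a b; rewrite /f.
rewrite -(coalgA_f _ cA (f := fun x y z => mul x (S b) ⊗ mul y (S z))); last by lin.
rewrite -[in RHS](coalg_er cA a) (bilin_tsuml mb) tpure_suml.
apply: eq_tsum => x y.
by rewrite -tpure_sumr Sright tpureZr (bilinZl mb) tpureZl.
Qed.
End Hopf.

(** * The antipode of a monoidal Hom-Hopf algebra *)

Section HomSpaces.
Variable K : fieldType.
Implicit Types M N : homSpace K.

Lemma xiK M : cancel (xi M) (xiV M).
Proof. exact: binvK (xi_bij M). Qed.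
Lemma xiVK M : cancel (xiV M) (xi M).
Proof. exact: binvKV (xi_bij M). Qed.
Lemma lin_xiV M : lin (xiV M).
Proof. exact: linear_can (@xiK M) (@xiVK M). Qed.

Lemma xi_inj M : injective (xi M).
Proof. exact: can_inj (@xiK M). Qed.

End HomSpaces.
#[export] Hint Resolve lin_xiV : lin.

Section HopfK.
Variables (K : fieldType) (H : homHopf K).
Notation mul := (@hmul K H).
Notation D := (hdelta H).
Notation S := (antipode H).

#[local] Hint Resolve hmul_bilin : lin.

Lemma lin_S : lin S. Proof. exact: (lin_of_linear (hS H)). Qed.
#[local] Hint Resolve lin_S : lin.

Lemma xiV_mul a b : xiV H (mul a b) = mul (xiV H a) (xiV H b).
Proof. by apply: (@xi_inj _ H); rewrite hmul_xi !xiVK. Qed.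

Lemma xiV_one : xiV H (hone H) = hone H.
Proof. by apply: (@xi_inj _ H); rewrite hone_xi xiVK. Qed.

Lemma S_xi h : S (xi H h) = xi H (S h).
Proof. exact: hS_xi. Qed.

Lemma xiV_S h : S (xiV H h) = xiV H (S h).
Proof. by apply: (@xi_inj _ H); rewrite xiVK -hS_xi xiVK. Qed.

Lemma eps_xiV h : heps H (xiV H h) = heps H h.
Proof. by rewrite -[in RHS](xiVK h) heps_xi. Qed.

Lemma D_xiV c : D (xiV H c) = \Sw_(c1, c2 <- D c) xiV H c1 ⊗ xiV H c2.
Proof.
rewrite -[in RHS](xiVK c) hdelta_xi tsum_tsum; last by lin.
rewrite -[LHS]tsum_tpure; apply: eq_tsum => a b; rewrite tsumE ?xiK //; lin.
Qed.

(** The axiom [hdeltaA], evaluated on a trilinear map. *)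
Lemma coassoc (V : lmodType K) (f : H -> H -> H -> V) c : trilin f ->
  \Sw_(c1, c2 <- D c) \Sw_(c21, c22 <- D c2) f (xiV H c1) c21 c22
  = \Sw_(c1, c2 <- D c) \Sw_(c11, c12 <- D c1) f c11 c12 (xiV H c2).
Proof.
move=> ft; have fb := tsum3_linear ft; have [f1 f2] := ft.
have := congr1 (tsum (fun x t => tsum (f x) t)) (hdeltaA c).
rewrite !tsum_tsum // => E; apply: etrans (etrans E _).
  apply: eq_tsum => x y; rewrite tsum_tsum //; apply: eq_tsum => a b.
  by rewrite tsumE // tsumE.
apply: eq_tsum => x y; rewrite tsum_tsum //; apply: eq_tsum => a b.
by rewrite tsumE // tsumE.
Qed.

(** [coassoc] with the twists moved to the side that is being introduced, so
    that it rewrites an arbitrary double sum; likewise [coassocR]. *)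
Lemma coassocL (V : lmodType K) (f : H -> H -> H -> V) c : trilin f ->
  \Sw_(c1, c2 <- D c) \Sw_(c21, c22 <- D c2) f c1 c21 c22
  = \Sw_(c1, c2 <- D c) \Sw_(c11, c12 <- D c1) f (xi H c11) c12 (xiV H c2).
Proof.
move=> [f1 f2]; rewrite -(coassoc (f := fun a b c => f (xi H a) b c)); last by lin.
by apply: eq_tsum => x y; rewrite xiVK.
Qed.

Lemma coassocR (V : lmodType K) (f : H -> H -> H -> V) c : trilin f ->
  \Sw_(c1, c2 <- D c) \Sw_(c11, c12 <- D c1) f c11 c12 c2
  = \Sw_(c1, c2 <- D c) \Sw_(c21, c22 <- D c2) f (xiV H c1) c21 (xi H c22).
Proof.
move=> [f1 f2]; rewrite (coassoc (f := fun a b c => f a b (xi H c))); last by lin.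
by apply: eq_tsum => x y; rewrite xiVK.
Qed.

(** Untwisting: these two operations make H an ordinary Hopf algebra with the
    given unit, counit and antipode. *)
Definition umul a b : H := xiV H (mul a b).
Definition uD c : tensor H H := \Sw_(c1, c2 <- D c) xi H c1 ⊗ xi H c2.

Lemma umul_alg : is_alg umul (hone H).
Proof.
rewrite /umul; split=> [|a b c|a|a]; first by lin.
- apply: (@xi_inj _ H); apply: (@xi_inj _ H).
  by rewrite !xiVK !hmul_xi !xiVK hmulA.
- by rewrite hmul1l xiK.
- by rewrite hmul1r xiK.
Qed.

Lemma uD_coalg : is_coalg uD (heps H).
Proof.
rewrite /uD; split=> [|||c|c]; [by lin|by lin| | |].
- move=> c; sw (@hdelta_xi K H).
  rewrite coassocL; last by lin.
  by swl (@xiVK K).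
- swl (@heps_xi K H); rewrite -[RHS]xiVK -hepsr (lin_tsumE (f := xi H)); last by lin.
  by apply: eq_tsum => a b; rewrite linearZ.
- swl (@heps_xi K H); rewrite -[RHS]xiVK -hepsl (lin_tsumE (f := xi H)); last by lin.
  by apply: eq_tsum => a b; rewrite linearZ.
Qed.

Lemma uDM a b : uD (umul a b) =
  \Sw_(a1, a2 <- uD a) \Sw_(b1, b2 <- uD b) umul a1 b1 ⊗ umul a2 b2.
Proof.
rewrite /uD /umul.
sw (D_xiV, @hdeltaM K H, @hmul_xi K H, @xiVK K, xiV_mul, @xiK K).
by [].
Qed.

Lemma uS_left h : \Sw_(h1, h2 <- uD h) umul (S h1) h2 = (heps H h : K) *: hone H.
Proof.
rewrite /uD /umul; swl (S_xi, xiV_mul, @xiK K); exact: hSl.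
Qed.

Lemma uS_right h : \Sw_(h1, h2 <- uD h) umul h1 (S h2) = (heps H h : K) *: hone H.
Proof.
rewrite /uD /umul; swl (S_xi, xiV_mul, @xiK K); exact: hSr.
Qed.

Lemma S_mul a b : S (mul a b) = mul (S b) (S a).
Proof.
have eM x y : heps H (umul x y) = (heps H x : K) * (heps H y : K).
  by rewrite eps_xiV hepsM.
have := antipode_mul umul_alg uD_coalg lin_S uDM eM uS_left uS_right a b.
by rewrite /umul xiV_S => /(congr1 (xi H)); rewrite !xiVK.
Qed.

Lemma S_delta h : D (S h) = \Sw_(h1, h2 <- D h) S h2 ⊗ S h1.
Proof.
have D1 : uD (hone H) = hone H ⊗ hone H.
  by rewrite /uD hdelta1 tsumE ?hone_xi //; lin.
have E := antipode_delta umul_alg uD_coalg lin_S uDM D1 uS_left uS_right h.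
transitivity (\Sw_(a, b <- uD (S h)) xiV H a ⊗ xiV H b).
  by rewrite -[LHS]tsum_tpure /uD; swr (@xiK K).
by rewrite E /uD; swl (S_xi, @xiK K).
Qed.

Lemma S_one : S (hone H) = hone H.
Proof.
have := hSl (hone H); rewrite hdelta1 tsumE; last by lin.
by rewrite hmul1r heps1 scale1r => E; apply: (@xi_inj _ H); rewrite E hone_xi.
Qed.

Lemma S_eps h : heps H (S h) = heps H h.
Proof.
have := congr1 (heps H) (hSl h).
rewrite (lin_tsumE (f := heps H)); last by lin.
rewrite linearZ /= heps1 => E; rewrite -[RHS]mulr1 -[RHS]E.
rewrite -[in LHS](xiVK h) S_xi heps_xi -hepsr.
rewrite (lin_tsumE (f := fun x => heps H (S x))); last by lin.
apply: eq_tsum => x y; rewrite (lin_scaleE _ _ (f := fun x => heps H (S x))); last by lin.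
by rewrite hepsM mulrC.
Qed.

End HopfK.

#[export] Hint Resolve hmul_bilin lin_S : lin.

(** * Powers of the antipode *)

Section Powers.
Variables (K : fieldType) (H : homHopf K).
Notation mul := (@hmul K H).
Notation D := (hdelta H).
Notation S := (antipode H).
Local Notation Spow := (@Spow K H).

Record hopf_end (f : H -> H) : Prop := HopfEnd {
  hopf_end_lin : lin f;
  hopf_end_xi : forall h, f (xi H h) = xi H (f h);
  hopf_end_mul : forall a b, f (mul a b) = mul (f a) (f b);
  hopf_end_one : f (hone H) = hone H;
  hopf_end_delta : forall h, D (f h) = \Sw_(h1, h2 <- D h) f h1 ⊗ f h2;
  hopf_end_eps : forall h, heps H (f h) = heps H h }.

Lemma hopf_end_id : hopf_end id.
Proof. by split=> // h; rewrite tsum_tpure. Qed.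

Lemma hopf_end_comp f g : hopf_end f -> hopf_end g -> hopf_end (fun h => f (g h)).
Proof.
move=> [fl fx fm f1 fd fe] [gl gx gm g1 gd ge]; split=> [|h|a b||h|h].
- exact: lin_comp.
- by rewrite gx fx.
- by rewrite gm fm.
- by rewrite g1 f1.
- by swl (fd, gd).
- by rewrite fe ge.
Qed.

Lemma hopf_end_can f g : cancel f g -> cancel g f -> hopf_end f -> hopf_end g.
Proof.
move=> fK gK [fl fx fm f1 fd fe].
have gl : lin g by move=> a u v; apply: (can_inj fK); rewrite fl !gK.
split=> // [h|a b||h|h].
- by apply: (can_inj fK); rewrite fx !gK.
- by apply: (can_inj fK); rewrite fm !gK.
- by rewrite -f1 fK.
- by rewrite -[in RHS](gK h); swr (fd, fK); rewrite tsum_tpure.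
- by rewrite -fe gK.
Qed.

Lemma hopf_end_SS : hopf_end (fun h => S (S h)).
Proof.
split=> [|h|a b||h|h]; first by lin.
- by rewrite !S_xi.
- by rewrite !S_mul.
- by rewrite !S_one.
- by swl (@S_delta K H).
- by rewrite !S_eps.
Qed.

Hypothesis S_bij : bijective S.

Lemma Spow_succ z h : Spow (z + 1) h = S (Spow z h).
Proof.
rewrite /Defs.Spow; case: z => n; first by rewrite -PoszD addn1.
have SK := binvKV (0 : H) S_bij.
case: n => [|n]; first by rewrite /= SK.
have -> : Negz n.+1 + 1 = Negz n by rewrite !NegzE -[n.+2]addn1 PoszD opprD addrNK.
by rewrite /= SK.
Qed.

Lemma Spow_pred z h : S (Spow (z - 1) h) = Spow z h.
Proof. by rewrite -Spow_succ subrK. Qed.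

Lemma Spow_add a b h : Spow (a + b) h = Spow a (Spow b h).
Proof.
elim: a h => [|n IHn|n IHn] h; first by rewrite add0r.
  by rewrite -[n.+1]addn1 PoszD addrAC !Spow_succ IHn.
apply: (bij_inj S_bij); rewrite -[n.+1]addn1 PoszD opprD.
by rewrite Spow_pred addrAC Spow_pred IHn.
Qed.

Lemma Spow_cancel z : cancel (Spow z : H -> H) (Spow (- z)).
Proof. by move=> h; rewrite -Spow_add addNr. Qed.

(** Even powers of S are automorphisms because S reverses products and
    coproducts, hence S^2 preserves them. *)
Lemma hopf_end_Spow z : hopf_end (Spow (2 * z)).
Proof.
have Spos (n : nat) : hopf_end (Spow (2 * n%:Z)).
  elim: n => [|n IHn]; first by rewrite mulr0; exact: hopf_end_id.
  have -> : Spow (2 * n.+1%:Z) = (fun h => S (S (Spow (2 * n%:Z) h))) :> (H -> H).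
    apply/funext => h; rewrite -[n.+1]addn1 PoszD mulrDr.
    by rewrite -[2 * 1]/(1 + 1 : int) addrA !Spow_succ.
  exact: (hopf_end_comp hopf_end_SS IHn).
case: z => n; first exact: Spos.
rewrite NegzE mulrN; apply: hopf_end_can (Spos n.+1); first exact: Spow_cancel.
by move=> h; rewrite -Spow_add subrr.
Qed.

(** Odd powers of S are reduced to even ones through S(S^(2z-1)(h)) = S^(2z)(h)
    and injectivity of S. *)
Lemma Spow_odd_mul z a b :
  Spow (2 * z - 1) (mul a b) = mul (Spow (2 * z - 1) b) (Spow (2 * z - 1) a).
Proof.
by apply: (bij_inj S_bij); rewrite S_mul !Spow_pred (hopf_end_mul (hopf_end_Spow z)).
Qed.

Lemma Spow_even z h : Spow (2 * z) h = Spow (2 * z - 1) (S h) :> H.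
Proof. by rewrite -[in LHS](subrK 1 (2 * z)) Spow_add. Qed.

Lemma lin_Spow_odd z : lin (Spow (2 * z - 1) : H -> H).
Proof.
move=> a u v; apply: (bij_inj S_bij).
by rewrite lin_S !Spow_pred (hopf_end_lin (hopf_end_Spow z)).
Qed.

Lemma Spow_odd_xi z h : Spow (2 * z - 1) (xi H h) = xi H (Spow (2 * z - 1) h).
Proof.
by apply: (bij_inj S_bij); rewrite S_xi !Spow_pred (hopf_end_xi (hopf_end_Spow z)).
Qed.

Lemma Spow_odd_one z : Spow (2 * z - 1) (hone H) = hone H.
Proof.
by apply: (bij_inj S_bij); rewrite S_one Spow_pred (hopf_end_one (hopf_end_Spow z)).
Qed.

End Powers.

(** * Hom-modules and Hom-comodules *)

Lemma lin_coact (K : fieldType) (H : homHopf K) (M : ydData H) :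
  is_hom_comodule M -> lin (@coact K H M).
Proof. exact: coact_linear. Qed.

#[export] Hint Resolve act_bilin lin_coact yd_module yd_comodule : lin.

Lemma lin_Spow_even (K : fieldType) (H : homHopf K) z : bijective (antipode H) ->
  lin (Spow (2 * z) : H -> H).
Proof. by move=> b; exact: hopf_end_lin (hopf_end_Spow b z). Qed.
#[export] Hint Resolve lin_Spow_even lin_Spow_odd : lin.

Section HomModules.
Variables (K : fieldType) (H : homHopf K).
Notation mul := (@hmul K H).
Notation D := (hdelta H).
Variable M : ydData H.
Hypotheses (mM : is_hom_module M) (cM : is_hom_comodule M).

Lemma act_xiV a (m : M) : xiV M (act a m) = act (xiV H a) (xiV M m).
Proof. by apply: (@xi_inj _ M); rewrite xiVK (act_xi mM) !xiVK. Qed.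

Lemma coact_xiV (m : M) :
  coact (xiV M m) = \Sw_(m0, m1 <- coact m) xiV M m0 ⊗ xiV H m1.
Proof.
rewrite -[in RHS](xiVK m) (coact_xi cM); swr (@xiK K).
by rewrite tsum_tpure.
Qed.

(** The axiom [coactA] on a trilinear map, with the twists moved to the side that
    is being introduced; likewise [coact_coassocR]. *)
Lemma coact_coassocL (V : lmodType K) (f : M -> H -> H -> V) m : trilin f ->
  \Sw_(m0, m1 <- coact m) \Sw_(m11, m12 <- D m1) f m0 m11 m12
  = \Sw_(m0, m1 <- coact m) \Sw_(m00, m01 <- coact m0) f (xi M m00) m01 (xiV H m1).
Proof.
move=> [f1 f2].
have := congr1 (tsum (fun x t => tsum (f (xi M x)) t)) (coactA cM m).
move=> E; apply: etrans (etrans E _).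
  by swr (@xiVK K).
by swl (@xiVK K).
Qed.

Lemma coact_coassocR (V : lmodType K) (f : M -> H -> H -> V) m : trilin f ->
  \Sw_(m0, m1 <- coact m) \Sw_(m00, m01 <- coact m0) f m00 m01 m1
  = \Sw_(m0, m1 <- coact m) \Sw_(m11, m12 <- D m1) f (xiV M m0) m11 (xi H m12).
Proof.
move=> [f1 f2]; rewrite (coact_coassocL (f := fun a b c => f (xiV M a) b (xi H c))).
  by swr (@xiVK K, @xiK K).
by lin.
Qed.

Lemma coact_tsum (U V : lmodType K) (g : U -> V -> M) t :
  coact (tsum g t) = \Sw_(x, y <- t) coact (g x y).
Proof. by apply: lin_tsumE; exact: coact_linear cM. Qed.

Lemma act_tsum (U V : lmodType K) (g : U -> V -> M) a t :
  act a (tsum g t) = \Sw_(x, y <- t) act a (g x y).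
Proof. exact: (bilin_tsumr (act_bilin mM)). Qed.
End HomModules.

(** * The exchange identity *)

Section Exchange.
Variables (K : fieldType) (H : homHopf K).
Hypothesis S_bij : bijective (antipode H).
Notation mul := (@hmul K H).
Notation D := (hdelta H).
Notation S := (antipode H).
Local Notation Sp := (@Spow K H).
Let Sx z := hopf_end_xi (hopf_end_Spow S_bij z).

(** The Yetter-Drinfeld condition freed of odd powers of the antipode. *)
Definition yd_exchange n (M : ydData H) : Prop := forall h (m : M),
  \Sw_(h1, h2 <- D h) \Sw_(m0, m1 <- coact m) act h1 m0 ⊗ mul h2 m1
  = \Sw_(h1, h2 <- D h) \Sw_(x0, x1 <- coact (act h2 (xiV M m)))
      xi M x0 ⊗ mul x1 (Sp (2 * n) h1).

Lemma yd_exchange_f n (M : ydData H) (V : lmodType K) (F : M -> H -> V) h m :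
  yd_exchange n M -> bilin F ->
  \Sw_(h1, h2 <- D h) \Sw_(m0, m1 <- coact m) F (act h1 m0) (mul h2 m1)
  = \Sw_(h1, h2 <- D h) \Sw_(x0, x1 <- coact (act h2 (xiV M m)))
      F (xi M x0) (mul x1 (Sp (2 * n) h1)).
Proof.
move=> E Fb; apply: etrans (etrans (congr1 (tsum F) (E h m)) _).
  by swr (@xiK K).
by swl (@xiK K).
Qed.

(** The factor S^(2n-1)(h_2) S^(2n)(h_1) = S^(2n-1)(S(h_1) h_2) that arises on the
    right collapses to the counit. *)
Lemma yd_exchangeP n M : is_yd n M -> yd_exchange n M.
Proof.
move=> yM h m; have [mM cM E] := yM.
swr (E, coact_xiV cM, act_xi mM, @xiVK K).
rewrite [RHS](coassocL (f := fun a b c => \Sw_(a0, b0 <- D c)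
  \Sw_(a1, b1 <- coact m) act (xi H (xi H a0)) a1
    ⊗ mul (mul (mul b0 (xiV H (xiV H b1))) (Sp (2 * n - 1) b)) (Sp (2 * n) a))); last by lin.
(* L a z collects everything but the argument z of S^(2n-1), so that the sum of
   the S(h_11) h_12 can be evaluated inside z. *)
pose L a z := \Sw_(a0, b0 <- D a) \Sw_(a1, b1 <- coact m)
  act (xi H a0) a1 ⊗ mul (mul b0 (xiV H b1)) (Sp (2 * n - 1) z).
have Lb : bilin L by rewrite /L; lin.
transitivity (\Sw_(h1, h2 <- D h) L h2 (\Sw_(h11, h12 <- D h1) mul (S h11) h12)).
  transitivity (L (xiV H h) (hone H)).
    rewrite /L D_xiV (Spow_odd_one S_bij).
    by swr (@hmul1r K H, @hmul_xi K H, @xiVK K).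
  rewrite -hepsl (bilin_tsuml Lb); apply: eq_tsum => a b.
  by rewrite hSl (bilinZl Lb) (bilinZr Lb).
apply: eq_tsum => a b; rewrite (bilin_tsumr Lb); apply: eq_tsum => c d; rewrite /L.
swr (@D_xiV K H, @xiVK K, Sx).
apply: eq_tsum => x y; apply: eq_tsum => u v.
by rewrite (Spow_odd_mul S_bij) -(Spow_even S_bij) -hmulA hmul_xi !xiVK.
Qed.

(** Conversely, S^(2n)(h_2) S^(2n-1)(h_1) = S^(2n-1)(h_1 S(h_2)) collapses after
    the identity has been applied to h_2 and multiplied by S^(2n-1)(h_1). *)
Lemma yd_of_exchange n M : is_hom_module M -> is_hom_comodule M ->
  yd_exchange n M -> is_yd n M.
Proof.
move=> mM cM E; split=> // h m.
pose L a z := \Sw_(x0, x1 <- coact (act a (xiV M (xiV M m))))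
  xi M (xi M x0) ⊗ mul (xi H x1) z.
have Lb : bilin L by rewrite /L; lin.
transitivity (\Sw_(h1, h2 <- D h) \Sw_(h21, h22 <- D h2)
   L h22 (mul (Sp (2 * n) h21) (Sp (2 * n - 1) (xiV H h1)))); last first.
  apply: eq_tsum => a b.
  transitivity (tsum (fun x y => xi M x ⊗ mul y (Sp (2 * n - 1) a))
    (\Sw_(h1, h2 <- D b) \Sw_(m0, m1 <- coact (xiV M m)) act h1 m0 ⊗ mul h2 m1)).
    rewrite E /L; swr (xiVK).
    apply: eq_tsum => x y; apply: eq_tsum => u v.
    by rewrite hmulA -(Spow_odd_xi S_bij) xiVK.
  by swl (coact_xiV cM, act_xi mM, @xiVK K).
rewrite (coassocL (f := fun x y z =>
  L z (mul (Sp (2 * n) y) (Sp (2 * n - 1) (xiV H x))))); last by lin.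
transitivity (\Sw_(h1, h2 <- D h) L (xiV H h2) (Sp (2 * n - 1)
   (\Sw_(h11, h12 <- D h1) mul h11 (S h12)))); last first.
  apply: eq_tsum => a b.
  rewrite (lin_tsumE (f := Sp (2 * n - 1))) ?(bilin_tsumr Lb); last by lin.
  apply: eq_tsum => c d.
  by rewrite xiK (Spow_even S_bij) (Spow_odd_mul S_bij).
transitivity (L (xiV H (xiV H h)) (hone H)).
  rewrite /L -!(act_xiV mM).
  by swr (coact_xiV cM, @hmul1r K H, @xiVK K); rewrite tsum_tpure.
rewrite -[in LHS](hepsl h) !(lin_tsumE (f := xiV H)) ?(bilin_tsuml Lb); try by lin.
apply: eq_tsum => a b; rewrite hSr !(lin_scaleE _ _ (f := xiV H)); try by lin.
rewrite (lin_scaleE _ _ (f := Sp (2 * n - 1))) ?(Spow_odd_one S_bij); last by lin.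
by rewrite (bilinZr Lb) (bilinZl Lb).
Qed.
End Exchange.

(** * Tensor products *)

Section HomTensor.
Variable K : fieldType.
Implicit Types L M N : homSpace K.

Lemma xi_tens M N (x : M) (y : N) :
  xi (htens M N) (x ⊗ y) = xi M x ⊗ xi N y.
Proof. by rewrite /= tmapE; [|exact: linearP..]. Qed.

Lemma xiV_tens M N (x : M) (y : N) :
  xiV (htens M N) (x ⊗ y) = xiV M x ⊗ xiV N y.
Proof. by apply: (@xi_inj _ (htens M N)); rewrite xiVK xi_tens !xiVK. Qed.

Lemma lin_hassoc L M N : lin (@hassoc K L M N).
Proof. by rewrite /hassoc; lin. Qed.

Lemma lin_hassocV L M N : lin (@hassocV K L M N).
Proof. by rewrite /hassocV; lin. Qed.

Lemma hassocE L M N (l : L) (m : M) (n : N) :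
  hassoc ((l ⊗ m) ⊗ n) = xi L l ⊗ (m ⊗ xiV N n).
Proof. by rewrite /hassoc tsumE ?tsumE //; lin. Qed.

Lemma hassocVE L M N (l : L) (m : M) (n : N) :
  hassocV (l ⊗ (m ⊗ n)) = (xiV L l ⊗ m) ⊗ xi N n.
Proof. by rewrite /hassocV tsumE ?tsumE //; lin. Qed.

Lemma hassoc_tsum L M N (U V : lmodType K) (g : U -> V -> htens (htens L M) N) t :
  hassoc (tsum g t) = \Sw_(u, v <- t) hassoc (g u v).
Proof. exact: lin_tsumE (@lin_hassoc L M N). Qed.

Lemma hassocV_tsum L M N (U V : lmodType K) (g : U -> V -> htens L (htens M N)) t :
  hassocV (tsum g t) = \Sw_(u, v <- t) hassocV (g u v).
Proof. exact: lin_tsumE (@lin_hassocV L M N). Qed.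

Lemma lin_hlunit M : lin (@hlunit K M).
Proof. by rewrite /hlunit; lin. Qed.

Lemma lin_hrunit M : lin (@hrunit K M).
Proof. by rewrite /hrunit; lin. Qed.

Lemma hlunitE M (a : K) (m : M) : hlunit ((a : hunit K) ⊗ m) = a *: xi M m.
Proof. by rewrite /hlunit tsumE //; lin. Qed.

Lemma hrunitE M (a : K) (m : M) : hrunit (m ⊗ (a : hunit K)) = a *: xi M m.
Proof. by rewrite /hrunit tsumE //; lin. Qed.

Lemma hlunitK M : cancel (@hlunit K M) (fun x => (1 : hunit K) ⊗ xiV M x).
Proof.
apply: tensor_ext => [||a x].
- have [_ pr] := @tpure_bilin K (hunit K) M.
  apply: (lin_comp (g := fun x => (1 : hunit K) ⊗ xiV M x)); last exact: lin_hlunit.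
  by apply: lin_comp; [exact: pr|exact: lin_xiV].
- exact: lin_id.
rewrite hlunitE (lin_scaleE _ _ (@lin_xiV _ M)) xiK tpureZr -tpureZl.
by rewrite /GRing.scale /= mulr1.
Qed.

Lemma hlunitVK M : cancel (fun x => (1 : hunit K) ⊗ xiV M x) (@hlunit K M).
Proof. by move=> x; rewrite hlunitE scale1r xiVK. Qed.

Lemma hrunitK M : cancel (@hrunit K M) (fun x => xiV M x ⊗ (1 : hunit K)).
Proof.
apply: tensor_ext => [||x a].
- have [pl _] := @tpure_bilin K M (hunit K).
  apply: (lin_comp (g := fun x => xiV M x ⊗ (1 : hunit K))); last exact: lin_hrunit.
  by apply: (lin_comp (g := fun y => y ⊗ (1 : hunit K))); [exact: pl|exact: lin_xiV].
- exact: lin_id.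
rewrite hrunitE (lin_scaleE _ _ (@lin_xiV _ M)) xiK tpureZl -tpureZr.
by rewrite /GRing.scale /= mulr1.
Qed.

Lemma hrunitVK M : cancel (fun x => xiV M x ⊗ (1 : hunit K)) (@hrunit K M).
Proof. by move=> x; rewrite hrunitE scale1r xiVK. Qed.

End HomTensor.
#[export] Hint Resolve lin_hassoc lin_hassocV lin_hlunit lin_hrunit : lin.

(** [tensor_ext] with the domain typed as a Yetter-Drinfeld datum, the form in
    which its action and coaction are known to be linear. *)
Lemma yd_tens_ext (K : fieldType) (H : homHopf K) n (M N : ydData H) (V : lmodType K)
    (f g : yd_tens n M N -> V) : lin f -> lin g ->
  (forall (x : M) (y : N), f (x ⊗ y) = g (x ⊗ y)) -> f =1 g.
Proof. exact: tensor_ext. Qed.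

Section TensorObject.
Variables (K : fieldType) (H : homHopf K).
Hypothesis S_bij : bijective (antipode H).
Notation mul := (@hmul K H).
Notation D := (hdelta H).
Local Notation Sp := (@Spow K H).
Let Sx z := hopf_end_xi (hopf_end_Spow S_bij z).
Let SM z := hopf_end_mul (hopf_end_Spow S_bij z).
Let SD z := hopf_end_delta (hopf_end_Spow S_bij z).

Variables (n : int) (M N : ydData H).
Notation T := (yd_tens n M N).
Section Module.
Hypotheses (mM : is_hom_module M) (mN : is_hom_module N).

Lemma tens_actE h (x : M) (y : N) :
  @act K H T h (x ⊗ y) = \Sw_(h1, h2 <- D h) act (Sp (2 * n) h1) x ⊗ act h2 y.
Proof. by rewrite /=; apply: eq_tsum => a b; rewrite tsumE //; lin. Qed.

Lemma tens_act_bilin : bilin (@act K H T).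
Proof. by rewrite /=; lin. Qed.

Lemma tens_module : is_hom_module T.
Proof.
have ab := tens_act_bilin.
split=> // [a b t|a t|t]; move: t; (apply: yd_tens_ext; [by lin|by lin|move=> x y]).
- rewrite tens_actE (bilin_tsumr ab).
  rewrite xi_tens tens_actE.
  swl (tens_actE, @hdelta_xi K H, Sx, actA mM, actA mN).
  swr (@hdeltaM K H, SM).
  by rewrite tsum_exchange.
- rewrite tens_actE (lin_tsumE (f := xi T)); last by lin.
  swl (xi_tens, act_xi mM, act_xi mN).
  by swr (xi_tens, tens_actE, @hdelta_xi K H, Sx).
- rewrite tens_actE hdelta1 tsumE ?xi_tens; last by lin.
  by rewrite (hopf_end_one (hopf_end_Spow S_bij n)) (act1 mM) (act1 mN).
Qed.
End Module.

Section Comodule.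
Hypotheses (cM : is_hom_comodule M) (cN : is_hom_comodule N).

Lemma tens_coactE (x : M) (y : N) :
  @coact K H T (x ⊗ y) = \Sw_(x0, x1 <- coact x) \Sw_(y0, y1 <- coact y)
    (x0 ⊗ y0) ⊗ mul y1 x1.
Proof. by rewrite /= tsumE //; lin. Qed.

Lemma lin_tens_coact : lin (@coact K H T).
Proof. by rewrite /=; lin. Qed.

Lemma tens_comodule : is_hom_comodule T.
Proof.
have cl := lin_tens_coact.
split=> // t; move: t; (apply: yd_tens_ext; [by lin|by lin|move=> x y]).
- rewrite tens_coactE.
  swl (@hdeltaM K H, xiV_tens, tens_coactE).
  swr (@hdeltaM K H, tens_coactE, @xiV_mul K H).
  transitivity (\Sw_(x0, x1 <- coact x) \Sw_(x00, x01 <- coact x0)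
    \Sw_(y0, y1 <- coact y) \Sw_(y11, y12 <- D y1)
      (x00 ⊗ xiV N y0) ⊗ (mul y11 x01 ⊗ mul y12 (xiV H x1))).
    rewrite (coact_coassocR cM (f := fun a b c => \Sw_(y0, y1 <- coact y)
      \Sw_(y11, y12 <- D y1) (a ⊗ xiV N y0) ⊗ (mul y11 b ⊗ mul y12 (xiV H c)))); last by lin.
    apply: eq_tsum => a b; rewrite [RHS]tsum_exchange; apply: eq_tsum => c d.
    by rewrite tsum_exchange; swr (@xiK K).
  apply: eq_tsum => a b; rewrite [RHS]tsum_exchange; apply: eq_tsum => c d.
  rewrite (coact_coassocR cN (f := fun u v w =>
    (c ⊗ u) ⊗ (mul v d ⊗ mul (xiV H w) (xiV H b)))); last by lin.
  by swr (@xiK K).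
- rewrite xi_tens !tens_coactE.
  swl (coact_xi cM, coact_xi cN).
  by swr (xi_tens, @hmul_xi K H).
- rewrite tens_coactE xiV_tens.
  swl (@hepsM K H).
  rewrite -(coact_eps cM x) -(coact_eps cN y).
  rewrite tpure_suml; apply: eq_tsum => a b; rewrite tpure_sumr; apply: eq_tsum => c d.
  by rewrite tpureZl tpureZr scalerA mulrC.
Qed.
End Comodule.

(** Up to powers of xi, h acts by S^(2n)(h_1) on x and by h_2 on y.  The identity
    of N turns h_2.y_0 ⊗ h_3 y_1 into (h_3.y)_0 ⊗ (h_3.y)_1 S^(2n)(h_2); what is left
    of x then has the form k_1.x_0 ⊗ k_2 x_1 for k = S^(2n)(h_1), to which the
    identity of M applies. *)
Lemma tens_exchange m : is_yd m M -> is_yd n N -> yd_exchange (m + n) T.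
Proof.
move=> yM yN.
have EM := yd_exchangeP S_bij yM; have EN := yd_exchangeP S_bij yN.
have [mM cM _] := yM; have [mN cN _] := yN.
have mT := tens_module mM mN; have cT := tens_comodule cM cN.
move=> h t; move: t; (apply: yd_tens_ext; [by lin|by lin|move=> x y]).
have taE := tens_actE mM mN; have tcE := tens_coactE cM cN.
rewrite xiV_tens.
transitivity (\Sw_(h1, h2 <- D h) \Sw_(h11, h12 <- D h1)
   \Sw_(x0, x1 <- coact x) \Sw_(y0, y1 <- coact y)
     (act (Sp (2 * n) h11) x0 ⊗ act h12 y0) ⊗ mul h2 (mul y1 x1)).
  swl (tcE, taE, @tpure_suml K); apply: eq_tsum => a b.
  by rewrite [RHS]tsum_exchange; apply: eq_tsum => c d; rewrite tsum_exchange.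
etransitivity.
  apply: (coassocR (f := fun a b c => \Sw_(x0, x1 <- coact x) \Sw_(y0, y1 <- coact y)
     (act (Sp (2 * n) a) x0 ⊗ act b y0) ⊗ mul c (mul y1 x1))); by lin.
cbv beta.
transitivity (\Sw_(h1, h2 <- D h) \Sw_(h21, h22 <- D h2) \Sw_(x0, x1 <- coact x)
   \Sw_(b0, b1 <- coact (act h22 (xiV N y)))
     (act (Sp (2 * n) (xiV H h1)) x0 ⊗ xi N b0) ⊗ mul (xi H b1) (mul (Sp (2 * n) h21) x1)).
  apply: eq_tsum => a b; rewrite tsum_exchange [RHS]tsum_exchange.
  apply: eq_tsum => c d.
  swl (@hmulA K H).
  etransitivity.
    apply: (yd_exchange_f (F := fun u v =>
      (act (Sp (2 * n) (xiV H a)) c ⊗ u) ⊗ mul v (xi H d)) b y EN).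
    by lin.
  apply: eq_tsum => u v; apply: eq_tsum => p q.
  by rewrite hmulA.
etransitivity.
  apply: (coassocL (f := fun a b c => \Sw_(x0, x1 <- coact x)
   \Sw_(b0, b1 <- coact (act c (xiV N y)))
     (act (Sp (2 * n) (xiV H a)) x0 ⊗ xi N b0) ⊗ mul (xi H b1) (mul (Sp (2 * n) b) x1))).
  by lin.
cbv beta.
transitivity (\Sw_(h1, h2 <- D h) \Sw_(h11, h12 <- D h1)
   \Sw_(b0, b1 <- coact (act (xiV H h2) (xiV N y)))
   \Sw_(a0, a1 <- coact (act (Sp (2 * n) h12) (xiV M x)))
     (xi M a0 ⊗ xi N b0) ⊗ mul (xi H b1) (mul a1 (Sp (2 * (m + n)) h11))).
  apply: eq_tsum => a b.
  transitivity (\Sw_(b0, b1 <- coact (act (xiV H b) (xiV N y)))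
    \Sw_(h1, h2 <- D (Sp (2 * n) a)) \Sw_(x0, x1 <- coact x)
     (act h1 x0 ⊗ xi N b0) ⊗ mul (xi H b1) (mul h2 x1)).
    rewrite [RHS]tsum_exchange; swr (SD, @xiK K); apply: eq_tsum => p q.
    by rewrite tsum_exchange; swl (@xiK K).
  rewrite [RHS]tsum_exchange; apply: eq_tsum => p q.
  etransitivity.
    apply: (yd_exchange_f (F := fun u v => (u ⊗ xi N p) ⊗ mul (xi H q) v) _ x EM).
    by lin.
  swl (SD); apply: eq_tsum => c d; apply: eq_tsum => u v.
  by rewrite mulrDr (Spow_add S_bij).
etransitivity.
  apply: (coassocR (f := fun a b c =>  \Sw_(b0, b1 <- coact (act (xiV H c) (xiV N y)))
   \Sw_(a0, a1 <- coact (act (Sp (2 * n) b) (xiV M x)))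
     (xi M a0 ⊗ xi N b0) ⊗ mul (xi H b1) (mul a1 (Sp (2 * (m + n)) a)))).
  by lin.
cbv beta; swr (taE, tcE, coact_tsum cT, xi_tens).
apply: eq_tsum => a b; apply: eq_tsum => c d.
rewrite tsum_exchange; swl (@xiK K); apply: eq_tsum => u v; apply: eq_tsum => p q.
by rewrite hmulA -Sx xiVK.
Qed.

End TensorObject.

(** * The unit object and the conjugates *)

Section UnitConj.
Variables (K : fieldType) (H : homHopf K).
Hypothesis S_bij : bijective (antipode H).
Notation mul := (@hmul K H).
Notation D := (hdelta H).
Local Notation Sp := (@Spow K H).
Let Sx z := hopf_end_xi (hopf_end_Spow S_bij z).
Let SM z := hopf_end_mul (hopf_end_Spow S_bij z).
Let SD z := hopf_end_delta (hopf_end_Spow S_bij z).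
Let S1 z := hopf_end_one (hopf_end_Spow S_bij z).
Let Se z := hopf_end_eps (hopf_end_Spow S_bij z).

Notation U := (yd_unit H).

Lemma xiV_unit (x : hunit K) : xiV (hunit K) x = x.
Proof. exact: (xiK (x : hunit K)). Qed.

Lemma unit_module : is_hom_module U.
Proof.
split=> [|a b x|a x|x] /=; first by lin.
- by rewrite heps_xi hepsM scalerA.
- by rewrite heps_xi.
- by rewrite heps1 scale1r.
Qed.

Lemma unit_comodule : is_hom_comodule U.
Proof.
split=> [|x|x|x] /=; first by apply/lin_linear; lin.
- swl (@hdelta1 K H, xiV_unit); swr (@xiV_one K H); by [].
- by swr (@hone_xi K H).
- by swl (@heps1 K H); rewrite scale1r xiV_unit.
Qed.

Lemma unit_exchange : yd_exchange 0 U.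
Proof.
move=> h x; rewrite /= xiV_unit.
transitivity ((x : K^o) ⊗ h).
  rewrite -[h in RHS](xiVK h) -hepsl (lin_tsumE (f := xi H)); last by lin.
  rewrite tpure_sumr; swl (@hmul1r K H, @tpureZl K).
  by apply: eq_tsum => a b; rewrite linearZ tpureZr.
rewrite -[h in LHS](xiVK h) -hepsr (lin_tsumE (f := xi H)); last by lin.
rewrite tpure_sumr; apply: eq_tsum => a b.
rewrite tsumE; last by lin.
by rewrite hmul1l linearZ tpureZl tpureZr.
Qed.

Section Conj.
Variables (m : int) (N : ydData H).
Notation C := (yd_conj m N).

Lemma conj_actE h (y : N) : @act K H C h y = act (Sp (2 * (- m)) h) y.
Proof. by rewrite /= mulrN. Qed.

Lemma conj_coactE (y : N) : @coact K H C y = \Sw_(y0, y1 <- coact y) y0 ⊗ Sp (2 * m) y1.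
Proof. by []. Qed.

Lemma conj_module : is_hom_module N -> is_hom_module C.
Proof.
move=> mN; split=> [|a b y|a y|y]; rewrite ?conj_actE.
- by rewrite /= -mulrN; lin.
- by rewrite Sx (actA mN) SM.
- by rewrite (act_xi mN) Sx.
- by rewrite S1 (act1 mN).
Qed.

Lemma conj_comodule : is_hom_comodule N -> is_hom_comodule C.
Proof.
move=> cN; split=> [|y|y|y]; rewrite /=; first by apply/lin_linear; lin.
- swl (SD); rewrite (coact_coassocL cN (f := fun a b c =>
    xiV N a ⊗ (Sp (2 * m) b ⊗ Sp (2 * m) c))); last by lin.
  have SxV h : Sp (2 * m) (xiV H h) = xiV H (Sp (2 * m) h).
    by apply: (@xi_inj _ H); rewrite -Sx !xiVK.
  by sw (@xiK K, SxV).
- by sw (coact_xi cN, Sx).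
- by swl (Se); rewrite (coact_eps cN).
Qed.

(** The exchange identity of N at k = S^(-2m)(h), with S^(2m) applied to the
    factor in H. *)
Lemma conj_exchange n : is_yd n N -> yd_exchange n C.
Proof.
move=> yN; have EN := yd_exchangeP S_bij yN; have [mN cN _] := yN.
have mC := conj_module mN; have cC := conj_comodule cN.
move=> h y; have SK x : Sp (2 * m) (Sp (2 * (- m)) x) = x.
  by rewrite -(Spow_add S_bij) -mulrDr subrr mulr0.
transitivity (\Sw_(k1, k2 <- D (Sp (2 * (- m)) h)) \Sw_(y0, y1 <- @coact K H N y)
   act k1 y0 ⊗ Sp (2 * m) (mul k2 y1)).
  by sw (conj_actE, conj_coactE, SD, SM, SK).
etransitivity.
  apply: (@yd_exchange_f K H n N (tensor C H) (fun u v => (u : C) ⊗ Sp (2 * m) v)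
    _ (y : N) EN); by lin.
swl (SD, SM); swr (conj_actE, conj_coactE).
apply: eq_tsum => a b; apply: eq_tsum => c d.
by rewrite -!(Spow_add S_bij) addrAC -mulrDr subrr mulr0 add0r.
Qed.
End Conj.

Lemma zmhyd_objectsP : zmhyd_objects H.
Proof.
split=> [M N||m N].
- have yM := zobjP M; have yN := zobjP N.
  apply: yd_of_exchange; first exact: S_bij.
  + exact: tens_module (yd_module yM) (yd_module yN).
  + exact: tens_comodule (yd_comodule yM) (yd_comodule yN).
  + exact: tens_exchange.
- exact: (yd_of_exchange S_bij unit_module unit_comodule unit_exchange).
- have yN := zobjP N; apply: (yd_of_exchange S_bij).
  + exact: conj_module (yd_module yN).
  + exact: conj_comodule (yd_comodule yN).
  + exact: conj_exchange.
Qed.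
End UnitConj.

(** * The structure maps are morphisms *)

Section Morphisms.
Variables (K : fieldType) (H : homHopf K).
Hypothesis S_bij : bijective (antipode H).
Notation mul := (@hmul K H).
Notation D := (hdelta H).
Local Notation Sp := (@Spow K H).
Let Sx z := hopf_end_xi (hopf_end_Spow S_bij z).
Let SD z := hopf_end_delta (hopf_end_Spow S_bij z).
Let Se z := hopf_end_eps (hopf_end_Spow S_bij z).
Implicit Types L M N : ydData H.

(** [is_zmor] without the degrees, so that it applies to [ydData]. *)
Record yd_hom M N (f : M -> N) : Prop := YdHom {
  yd_hom_lin : lin f;
  yd_hom_act : forall h (m : M), f (act h m) = act h (f m);
  yd_hom_coact : forall m : M, coact (f m) = \Sw_(m0, m1 <- coact m) f m0 ⊗ m1 }.

Lemma yd_hom_can M N (f : M -> N) (g : N -> M) :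
  cancel f g -> cancel g f -> yd_hom f -> yd_hom g.
Proof.
move=> fK gK [fl fa fc].
have gl : lin g by move=> a u v; apply: (can_inj fK); rewrite fl !gK.
split=> // [h n|n]; first by apply: (can_inj fK); rewrite fa !gK.
rewrite -[in RHS](gK n) fc; swr (fK); by rewrite tsum_tpure.
Qed.

Lemma yd_tens3_ext (n m : int) L M N (V : lmodType K)
    (f g : yd_tens n (yd_tens m L M) N -> V) : lin f -> lin g ->
  (forall (x : L) (y : M) (z : N), f ((x ⊗ y) ⊗ z) = g ((x ⊗ y) ⊗ z)) -> f =1 g.
Proof. exact: tensor3_ext. Qed.

Lemma act_act M a b (m : M) : is_hom_module M ->
  act a (act b m) = act (mul (xiV H a) b) (xi M m).
Proof. by move=> mM; rewrite -[a in LHS]xiVK (actA mM). Qed.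

Lemma tens_hom n M M' N N' (f : M -> M') (g : N -> N') :
  is_hom_module M -> is_hom_module N -> is_hom_module M' -> is_hom_module N' ->
  is_hom_comodule M -> is_hom_comodule N -> is_hom_comodule M' -> is_hom_comodule N' ->
  yd_hom f -> yd_hom g -> @yd_hom (yd_tens n M N) (yd_tens n M' N') (tmap f g).
Proof.
move=> mM mN mM' mN' cM cN cM' cN' [fl fa fc] [gl ga gc].
have tl : lin (tmap f g) by exact: tmap_linear.
have tE x y := tmap_pure x y fl gl.
have mT := tens_module S_bij n mM mN; have cT := tens_comodule n cM cN.
have mT' := tens_module S_bij n mM' mN'; have cT' := tens_comodule n cM' cN'.
split=> // [h t|t]; move: t; (apply: yd_tens_ext; [by lin|by lin|move=> x y]).
- rewrite tE !tens_actE // (lin_tsumE (f := tmap f g)) //.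
  by swl (tE, fa, ga).
- rewrite tE !tens_coactE //; swl (fc, gc).
  by swr (tE).
Qed.

Lemma assoc_hom l m n L M N : is_yd l L -> is_yd m M -> is_yd n N ->
  @yd_hom (yd_tens n (yd_tens m L M) N) (yd_tens (m + n) L (yd_tens n M N))
     (@hassoc K L M N).
Proof.
move=> yL yM yN.
have [mL cL _] := yL; have [mM cM _] := yM; have [mN cN _] := yN.
have mLM := tens_module S_bij m mL mM; have cLM := tens_comodule m cL cM.
have mMN := tens_module S_bij n mM mN; have cMN := tens_comodule n cM cN.
have mT := tens_module S_bij n mLM mN; have cT := tens_comodule n cLM cN.
have mT' := tens_module S_bij (m + n) mL mMN; have cT' := tens_comodule (m + n) cL cMN.
have al := @lin_hassoc K L M N.
split=> // [h t|t]; move: t; (apply: yd_tens3_ext; [by lin|by lin|move=> x y z]).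
- have taL := tens_actE m mL mM; have taN := tens_actE n mM mN.
  rewrite hassocE !tens_actE // hassoc_tsum.
  swl (taL, @hassoc_tsum K, @tpure_suml K, SD, hassocE, act_xi mL, act_xiV mN).
  swr (taN, @tpure_sumr K).
  rewrite [RHS](coassocL (f := fun a b c => act (Sp (2 * (m + n)) a) (xi L x)
    ⊗ (act (Sp (2 * n) b) y ⊗ act c (xiV N z)))); last by lin.
  apply: eq_tsum => a b; apply: eq_tsum => c d.
  by rewrite Sx mulrDr (Spow_add S_bij).
- have tcL := tens_coactE m cL cM; have tcN := tens_coactE n cM cN.
  rewrite hassocE !tens_coactE //.
  swl (tcN, coact_xi cL, coact_xiV cN).
  swr (tcL, hassocE).
  apply: eq_tsum => a b; apply: eq_tsum => c d; apply: eq_tsum => u v.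
  by rewrite -hmulA xiVK.
Qed.

Lemma hassocK (L M N : homSpace K) : cancel (@hassoc K L M N) (@hassocV K L M N).
Proof.
apply: tensor3_ext => [||l m n].
- exact: lin_comp (@lin_hassocV K L M N) (@lin_hassoc K L M N).
- exact: lin_id.
- by rewrite hassocE hassocVE xiK xiVK.
Qed.

Lemma hassocVK (L M N : homSpace K) : cancel (@hassocV K L M N) (@hassoc K L M N).
Proof.
apply: tensor3_extr => [||l m n].
- exact: lin_comp (@lin_hassoc K L M N) (@lin_hassocV K L M N).
- exact: lin_id.
- by rewrite hassocVE hassocE xiVK xiK.
Qed.

Lemma unit_actE h (x : hunit K) : @act K H (yd_unit H) h x = (heps H h : K) * (x : K).
Proof. by []. Qed.

Lemma unit_coactE (x : hunit K) : @coact K H (yd_unit H) x = x ⊗ hone H.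
Proof. by []. Qed.

Lemma lunit_hom n M : is_hom_module M -> is_hom_comodule M ->
  @yd_hom (yd_tens n (yd_unit H) M) M (@hlunit K M).
Proof.
move=> mM cM; have mU := unit_module H; have cU := unit_comodule H.
have ul := @lin_hlunit K M; have ab := act_bilin mM; have cl := lin_coact cM.
have mT := tens_module S_bij n mU mM; have cT := tens_comodule n cU cM.
split=> // [h t|t]; move: t; (apply: yd_tens_ext; [by lin|by lin|move=> x y]).
- rewrite hlunitE tens_actE // (lin_tsumE (f := @hlunit K M)) //.
  swl (@hlunitE K, unit_actE, Se).
  rewrite (bilinZr ab) -[h in RHS]xiVK -(act_xi mM) -hepsl (bilin_tsuml ab).
  rewrite (lin_tsumE (f := xi M)) ?scale_tsum; last by lin.
  by apply: eq_tsum => a b; rewrite (bilinZl ab) linearZ scalerA mulrC.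
- rewrite hlunitE tens_coactE // (lin_scaleE _ _ cl) (coact_xi cM) scale_tsum.
  swr (unit_coactE, @hlunitE K, @hmul1r K H).
  by apply: eq_tsum => a b; rewrite tpureZl.
Qed.

Lemma runit_hom M : is_hom_module M -> is_hom_comodule M ->
  @yd_hom (yd_tens 0 M (yd_unit H)) M (@hrunit K M).
Proof.
move=> mM cM; have mU := unit_module H; have cU := unit_comodule H.
have ul := @lin_hrunit K M; have ab := act_bilin mM; have cl := lin_coact cM.
have mT := tens_module S_bij 0 mM mU; have cT := tens_comodule 0 cM cU.
split=> // [h t|t]; move: t; (apply: yd_tens_ext; [by lin|by lin|move=> x y]).
- rewrite hrunitE tens_actE // (lin_tsumE (f := @hrunit K M)) //.
  swl (@hrunitE K, unit_actE).
  rewrite (bilinZr ab) -[h in RHS]xiVK -(act_xi mM) -hepsr (bilin_tsuml ab).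
  rewrite (lin_tsumE (f := xi M)) ?scale_tsum; last by lin.
  by apply: eq_tsum => a b; rewrite (bilinZl ab) linearZ scalerA mulrC mulr0.
- rewrite hrunitE tens_coactE // (lin_scaleE _ _ cl) (coact_xi cM) scale_tsum.
  swr (unit_coactE, @hrunitE K, @hmul1l K H).
  by apply: eq_tsum => a b; rewrite tpureZl.
Qed.

Lemma conj_hom m M N (f : M -> N) : yd_hom f -> @yd_hom (yd_conj m M) (yd_conj m N) f.
Proof.
move=> [fl fa fc]; split=> // [h x|x]; first exact: fa.
by rewrite /=; sw (fc).
Qed.

Lemma lin_braid M N : is_hom_module M -> is_hom_comodule N -> lin (@yd_braid K H M N).
Proof. by move=> mM cN; rewrite /yd_braid; lin. Qed.

Lemma braidE M N (x : M) (y : N) : is_hom_module M -> is_hom_comodule N ->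
  yd_braid (x ⊗ y) = \Sw_(y0, y1 <- coact y) xi N y0 ⊗ act y1 (xiV M x).
Proof. by move=> mM cN; rewrite /yd_braid tsumE //; lin. Qed.

(** Linearity: (h_2.y)_0 ⊗ (h_2.y)_1 S^(2n)(h_1).x = h_1.y_0 ⊗ (h_2 y_1).x is the
    exchange identity of N, and the conjugation by m undoes the S^(2m) that the
    tensor product puts on h_1.  Colinearity: the coaction of the target produces
    (y_2.x)_0 ⊗ (y_2.x)_1 S^(2m)(y_1), the exchange identity of M for y_1. *)
Lemma braid_hom m n M N : is_yd m M -> is_yd n N ->
  @yd_hom (yd_tens n M N) (yd_tens m (yd_conj m N) M) (@yd_braid K H M N).
Proof.
move=> yM yN; have [mM cM _] := yM; have [mN cN _] := yN.
have EM := yd_exchangeP S_bij yM; have EN := yd_exchangeP S_bij yN.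
have mC := conj_module S_bij m mN; have cC := conj_comodule S_bij m cN.
have mT := tens_module S_bij n mM mN; have cT := tens_comodule n cM cN.
have mT' := tens_module S_bij m mC mM; have cT' := tens_comodule m cC cM.
have bl := lin_braid mM cN; have bE x y := @braidE M N x y mM cN.
have SK z x : Sp (2 * (- z)) (Sp (2 * z) x) = x.
  by rewrite -(Spow_add S_bij) -mulrDr addNr mulr0.
have SxV z x : xiV H (Sp (2 * z) x) = Sp (2 * z) (xiV H x).
  by apply: (@xi_inj _ H); rewrite -Sx !xiVK.
have acV a (u : N) : act (xiV H a) (xiV N u) = xiV N (act a u).
  by rewrite (act_xiV mN).
have aa a b (u : M) := act_act a b u mM.
have tE' h (x : yd_conj m N) (y : M) := tens_actE m mC mM h x y.
have tcE' (x : yd_conj m N) (y : M) := tens_coactE m cC cM x y.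
have cE := @conj_actE K H m N; have ccE := @conj_coactE K H m N.
split=> // [h t|t]; move: t; (apply: yd_tens_ext; [by lin|by lin|move=> x y]).
- rewrite bE tens_actE // (lin_tsumE (f := @yd_braid K H M N)) //.
  swl (bE, act_xiV mM).
  transitivity (\Sw_(k1, k2 <- D (xiV H h)) \Sw_(y0, y1 <- coact y)
    xi N (act k1 y0) ⊗ act (mul k2 y1) x).
    rewrite [RHS](yd_exchange_f (F := fun u v => xi N u ⊗ act v x) _ y EN); last by lin.
    swr (@D_xiV K H, acV, coact_xiV cN, @xiVK K).
    apply: eq_tsum => a b; apply: eq_tsum => c d.
    by rewrite aa SxV xiVK.
  swl (@D_xiV K H, act_xi mN, @xiVK K).
  swr (act_tsum mT', tE', cE, SK, aa, @xiVK K).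
  by rewrite tsum_exchange.
- rewrite bE tens_coactE //.
  swl (coact_tsum cT', tcE', ccE, coact_xi cN).
  swr (bE, @tpure_suml K).
  etransitivity.
    apply: (coact_coassocR cN (f := fun a b c => \Sw_(u, v <- coact (act c (xiV M x)))
      (xi N a ⊗ u) ⊗ mul v (Sp (2 * m) (xi H b)))); by lin.
  transitivity (\Sw_(y0, y1 <- coact y) \Sw_(y11, y12 <- D y1) \Sw_(x0, x1 <- coact x)
    (y0 ⊗ act y11 (xiV M x0)) ⊗ mul (xi H y12) x1); last first.
    rewrite [RHS]tsum_exchange.
    transitivity (\Sw_(y0, y1 <- coact y) \Sw_(y00, y01 <- coact y0) \Sw_(x0, x1 <- coact x)
      (xi N y00 ⊗ act y01 (xiV M x0)) ⊗ mul y1 x1); last first.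
      by apply: eq_tsum => a b; rewrite tsum_exchange.
    symmetry; etransitivity.
      apply: (coact_coassocR cN (f := fun a b c => \Sw_(x0, x1 <- coact x)
        (xi N a ⊗ act b (xiV M x0)) ⊗ mul c x1)); by lin.
    by swl (@xiVK K).
  apply: eq_tsum => a b.
  transitivity (\Sw_(k1, k2 <- D (xi H b)) \Sw_(x0, x1 <- coact x)
    (a ⊗ xiV M (act k1 x0)) ⊗ mul k2 x1); last first.
    by swl (@hdelta_xi K H, act_xiV mM, @xiK K).
  symmetry; etransitivity.
    apply: (yd_exchange_f (F := fun u v => (a ⊗ xiV M u) ⊗ v) _ x EM); by lin.
  by swl (@hdelta_xi K H, @xiK K); swr (@xiVK K).
Qed.

Lemma zmor_yd_hom (M N : zobj H) (f : zmor M N) : yd_hom f.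
Proof. by have [_ fl fa fc] := zmorP f; split. Qed.
Lemma zmhyd_morphismsP (w : zmhyd_objects H) : zmhyd_morphisms w.
Proof.
have zh (M N : zobj H) (f : M -> N) : zdeg M = zdeg N -> yd_hom f -> is_zmor f.
  by move=> d [fl fa fc]; split.
have mod (M : zobj H) : is_hom_module M := yd_module (zobjP M).
have com (M : zobj H) : is_hom_comodule M := yd_comodule (zobjP M).
have asP (L M N : zobj H) : yd_hom (M := ztens w (ztens w L M) N)
    (N := ztens w L (ztens w M N)) (@hassoc K L M N).
  exact: assoc_hom (zobjP L) (zobjP M) (zobjP N).
split=> [M M' N N' f g|L M N|L M N|M|M|m M N f|M N].
- apply: zh; first by rewrite /= (zmor_deg (zmorP f)) (zmor_deg (zmorP g)).
  rewrite /= -(zmor_deg (zmorP g)).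
  by apply: tens_hom => //; exact: zmor_yd_hom.
- by apply: zh; [rewrite /= addrA|exact: asP].
- apply: zh; first by rewrite /= addrA.
  apply: (@yd_hom_can (ztens w (ztens w L M) N) (ztens w L (ztens w M N))
    (@hassoc K L M N)); [exact: hassocK|exact: hassocVK|exact: asP].
- by apply: zh; [rewrite /= add0r|exact: lunit_hom].
- by apply: zh; [rewrite /= addr0|exact: runit_hom].
- by apply: zh; [exact: zmor_deg (zmorP f)|exact: conj_hom (zmor_yd_hom f)].
- by apply: zh; [rewrite /= addrC|exact: braid_hom (zobjP M) (zobjP N)].
Qed.

End Morphisms.

(** * The inverse of the braiding *)

Section Braid.
Variables (K : fieldType) (H : homHopf K).
Notation mul := (@hmul K H).
Notation D := (hdelta H).
Notation S := (antipode H).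

Variables M N : ydData H.
Hypotheses (mM : is_hom_module M) (cN : is_hom_comodule N).

Definition braidV (t : htens N M) : htens M N :=
  \Sw_(y, x <- t) \Sw_(y0, y1 <- coact y) act (S y1) (xiV M x) ⊗ xi N y0.

Lemma lin_braidV : lin braidV.
Proof. by rewrite /braidV; lin. Qed.

Lemma braidVE (y : N) (x : M) :
  braidV (y ⊗ x) = \Sw_(y0, y1 <- coact y) act (S y1) (xiV M x) ⊗ xi N y0.
Proof. by rewrite /braidV tsumE //; lin. Qed.

Let aa a b (u : M) := act_act a b u mM.

Lemma braidK : cancel (@yd_braid K H M N) braidV.
Proof.
have bl := lin_braid mM cN; have vl := lin_braidV.
apply: tensor_ext => [||x y]; [exact: (lin_comp vl bl)|exact: lin_id|].
rewrite braidE // (lin_tsumE _ _ vl).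
swl (braidVE, coact_xi cN).
etransitivity.
  apply: (coact_coassocR cN (f := fun a b c =>
    act (S (xi H b)) (xiV M (act c (xiV M x))) ⊗ xi N (xi N a))); by lin.
transitivity (\Sw_(y0, y1 <- coact y)
  act (\Sw_(a, b <- D y1) mul (S a) b) (xiV M x) ⊗ xi N y0).
  apply: eq_tsum => a b; rewrite (bilin_tsuml (act_bilin mM)) tpure_suml.
  by swl (act_xiV mM, aa, S_xi, @xiK K, @xiVK K).
transitivity (x ⊗ xi N (\Sw_(y0, y1 <- coact y) heps H y1 *: y0)).
  rewrite (lin_tsumE (f := xi N)) ?tpure_sumr; last by lin.
  apply: eq_tsum => a b.
  by rewrite hSl (bilinZl (act_bilin mM)) (act1 mM) xiVK linearZ tpureZl tpureZr.
by rewrite (coact_eps cN) xiVK.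
Qed.

Lemma braidVK : cancel braidV (@yd_braid K H M N).
Proof.
have bl := lin_braid mM cN; have vl := lin_braidV.
apply: tensor_ext => [||y x]; [exact: (lin_comp bl vl)|exact: lin_id|].
rewrite braidVE (lin_tsumE _ _ bl).
swl ((fun x y => braidE x y mM cN), coact_xi cN).
etransitivity.
  apply: (coact_coassocR cN (f := fun a b c =>
    xi N (xi N a) ⊗ act (xi H b) (xiV M (act (S c) (xiV M x))))); by lin.
transitivity (\Sw_(y0, y1 <- coact y)
  xi N y0 ⊗ act (\Sw_(a, b <- D y1) mul a (S b)) (xiV M x)).
  apply: eq_tsum => a b; rewrite (bilin_tsuml (act_bilin mM)) tpure_sumr.
  by swl (act_xiV mM, aa, S_xi, @xiK K, @xiVK K).
transitivity (xi N (\Sw_(y0, y1 <- coact y) heps H y1 *: y0) ⊗ x).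
  rewrite (lin_tsumE (f := xi N)) ?tpure_suml; last by lin.
  apply: eq_tsum => a b.
  by rewrite hSr (bilinZl (act_bilin mM)) (act1 mM) xiVK linearZ tpureZl tpureZr.
by rewrite (coact_eps cN) xiVK.
Qed.
End Braid.

(** * Hexagons, naturality and conjugation of the braiding *)

Section Hexagons.
Variables (K : fieldType) (H : homHopf K).
Hypothesis S_bij : bijective (antipode H).
Local Notation Sp := (@Spow K H).
Variables U V W : ydData H.
Hypotheses (mU : is_hom_module U) (mV : is_hom_module V).
Hypotheses (cV : is_hom_comodule V) (cW : is_hom_comodule W).

(** On pure tensors both sides are xi(w_0) ⊗ (S^(2q)(w_11).xi^-1(u) ⊗ w_12.xi^-1(v)),
    after coassociativity of the coaction of W. *)
Lemma hexagon_l q (t : htens (htens U V) W) :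
  @yd_braid K H (yd_tens q U V) W t =
  @hassoc K W U V (tmap (@yd_braid K H U (yd_conj q W)) id
    (@hassocV K U W V (tmap id (@yd_braid K H V W) (@hassoc K U V W t)))).
Proof.
have cC := conj_comodule S_bij q cW.
have mT := tens_module S_bij q mU mV.
have b1 := lin_braid mT cW; have b2 := lin_braid mU cC; have b3 := lin_braid mV cW.
have t1 : lin (tmap (@yd_braid K H U (yd_conj q W)) (@id V)) by exact: tmap_linear.
have t2 : lin (tmap (@id U) (@yd_braid K H V W)) by exact: tmap_linear.
have t1E (x : tensor U W) y := tmap_pure x y b2 (@lin_id K V).
have t2E x (y : tensor V W) := tmap_pure x y (@lin_id K U) b3.
have b1E (x : yd_tens q U V) y := braidE x y mT cW.
have b2E x (y : yd_conj q W) := braidE x y mU cC.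
have b3E x y := braidE x y mV cW.
move: t; apply: tensor3_ext => [||u v w].
- exact: b1.
- exact: (lin_comp (@lin_hassoc K W U V) (lin_comp t1
    (lin_comp (@lin_hassocV K U W V) (lin_comp t2 (@lin_hassoc K U V W))))).
rewrite hassocE t2E b3E b1E.
swl (xiV_tens, tens_actE q mU mV).
have t1s (A B : lmodType K) (g : A -> B -> _) s := lin_tsumE g s t1.
swr (coact_xiV cW, @tpure_sumr K, @tpure_suml K, @hassocV_tsum K, @hassocVE K,
  @xiK K, @xiVK K, t1s, t1E, b2E, @conj_coactE K H q W, @hassoc_tsum K, @hassocE K).
symmetry; etransitivity.
  apply: (coact_coassocR cW (f := fun a b c => xi W (xi W a) ⊗
    (act (Sp (2 * q) b) (xiV U u) ⊗ act (xiV H c) (xiV V v)))); by lin.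
by swl (@xiVK K, @xiK K); swr (@tpure_sumr K).
Qed.

(** On pure tensors the sides differ by (w_1 v_1).xi^-1(u) = xi(w_1).(v_1.xi^-2(u)). *)
Lemma hexagon_r n (t : htens U (htens V W)) :
  @yd_braid K H U (yd_tens n V W) t =
  @hassocV K V W U (tmap id (@yd_braid K H U W)
    (@hassoc K V U W (tmap (@yd_braid K H U V) id (@hassocV K U V W t)))).
Proof.
have cT := tens_comodule n cV cW.
have b1 := lin_braid mU cT; have b2 := lin_braid mU cV; have b3 := lin_braid mU cW.
have t1 : lin (tmap (@yd_braid K H U V) (@id W)) by exact: tmap_linear.
have t2 : lin (tmap (@id V) (@yd_braid K H U W)) by exact: tmap_linear.
have t1E (x : tensor U V) y := tmap_pure x y b2 (@lin_id K W).
have t2E x (y : tensor U W) := tmap_pure x y (@lin_id K V) b3.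
have b1E x (y : yd_tens n V W) := braidE x y mU cT.
have b2E x y := braidE x y mU cV.
have b3E x y := braidE x y mU cW.
have t2s (A B : lmodType K) (g : A -> B -> _) s := lin_tsumE g s t2.
move: t; apply: tensor3_extr => [||u v w].
- exact: b1.
- exact: (lin_comp (@lin_hassocV K V W U) (lin_comp t2
    (lin_comp (@lin_hassoc K V U W) (lin_comp t1 (@lin_hassocV K U V W))))).
rewrite hassocVE t1E b2E b1E.
swl (xi_tens, tens_coactE n cV cW).
swr (@tpure_suml K, @hassoc_tsum K, @hassocE K, @xiK K, t2s, t2E, b3E, @tpure_sumr K,
  @hassocV_tsum K, @hassocVE K).
apply: eq_tsum => a b; apply: eq_tsum => c d.
by rewrite (act_xi mU) xiVK (actA mU) xiVK.
Qed.
End Hexagons.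

Section Conj.
Variables (K : fieldType) (H : homHopf K).
Hypothesis S_bij : bijective (antipode H).

(** The twist S^(2b) of the coaction of N meets the twist S^(-2b) of the action on
    M. *)
Lemma braid_conj b (M N : ydData H) (t : htens M N) :
  is_hom_module M -> is_hom_comodule N ->
  @yd_braid K H M N t = @yd_braid K H (yd_conj b M) (yd_conj b N) t.
Proof.
move=> mM cN; have mC := conj_module S_bij b mM; have cC := conj_comodule S_bij b cN.
have b1 := lin_braid mM cN; have b2 := lin_braid mC cC.
move: t; apply: tensor_ext => [||x y]; [exact: b1|exact: b2|].
rewrite braidE //.
have -> := @braidE K H (yd_conj b M) (yd_conj b N) x y mC cC.
swr (@conj_actE K H, @conj_coactE K H); apply: eq_tsum => u v.
by rewrite -(Spow_add S_bij) -mulrDr addNr mulr0.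
Qed.
End Conj.

Section Natural.
Variables (K : fieldType) (H : homHopf K).

Lemma braid_natural (M M' N N' : ydData H) (f : M -> M') (g : N -> N') t :
  is_hom_module M -> is_hom_comodule N -> is_hom_module M' -> is_hom_comodule N' ->
  yd_hom f -> yd_hom g -> (forall y, g (xi N y) = xi N' (g y)) ->
  (forall x, f (xiV M x) = xiV M' (f x)) ->
  tmap g f (@yd_braid K H M N t) = @yd_braid K H M' N' (tmap f g t).
Proof.
move=> mM cN mM' cN' [fl fa fc] [gl ga gc] gx fx.
have b1 := lin_braid mM cN; have b2 := lin_braid mM' cN'.
have t1 : lin (tmap f g) by exact: tmap_linear.
have t2 : lin (tmap g f) by exact: tmap_linear.
have t1E x y := tmap_pure x y fl gl; have t2E x y := tmap_pure x y gl fl.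
move: t; apply: tensor_ext => [||x y].
- exact: (lin_comp t2 b1).
- exact: (lin_comp b2 t1).
rewrite t1E !braidE // (lin_tsumE _ _ t2).
by sw (gc, t2E, fa, fx, gx).
Qed.

(** By [act1], xi is the action of the unit of H. *)
Lemma zmor_xi (M N : zobj H) (f : zmor M N) x : f (xi M x) = xi N (f x).
Proof.
by rewrite -(act1 (yd_module (zobjP M))) -(act1 (yd_module (zobjP N))) (zmor_act (zmorP f)).
Qed.

Lemma zmor_xiV (M N : zobj H) (f : zmor M N) x : f (xiV M x) = xiV N (f x).
Proof. by apply: (@xi_inj _ N); rewrite -zmor_xi !xiVK. Qed.
End Natural.

(** * The braided T-category *)

Section Equalities.
Variables (K : fieldType) (H : homHopf K).
Hypothesis S_bij : bijective (antipode H).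
Let SD z := hopf_end_delta (hopf_end_Spow S_bij z).
Implicit Types M N : ydData H.

Definition hcast (M N : homSpace K) (e : M = N) (x : M) : N :=
  eq_rect M (fun L : homSpace K => L) x N e.

(** In all uses the underlying Hom-spaces are convertible, [iA] and [iB] are
    [erefl] and the casts vanish: arrows between equal objects are compared as
    functions. *)
Lemma zmor_arrow_eq (A A' B B' : zobj H) (f : zmor A B) (f' : zmor A' B')
    (iA : ysp A = ysp A') (iB : ysp B = ysp B') : A = A' -> B = B' ->
  (forall x : A, hcast iB (f x) = f' (hcast iA x)) ->
  @arrow_eq (ZMHYD H) A B f A' B' f'.
Proof.
move=> eA eB; case: A' / eA f' iA => f' iA; case: B' / eB f' iB => f' iB.
rewrite (Prop_irrelevance iA erefl) (Prop_irrelevance iB erefl) /= => ff'.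
by rewrite (zmor_eq ff' : f = f').
Qed.

Lemma zobj_eq n n' (M N : ydData H) (yM : is_yd n M) (yN : is_yd n' N) :
  n = n' -> M = N -> ZObj yM = ZObj yN.
Proof.
move=> nn MN; case: n' / nn yN => yN; case: N / MN yN => yN.
by rewrite (Prop_irrelevance yM yN).
Qed.

Lemma conj_tens b n M N : is_yd n N -> is_hom_module M -> is_hom_comodule M ->
  yd_conj b (yd_tens n M N) = yd_tens n (yd_conj b M) (yd_conj b N).
Proof.
move=> yN mM cM; have [mN cN _] := yN.
have mCM := conj_module S_bij b mM; have mCN := conj_module S_bij b mN.
have cCM := conj_comodule S_bij b cM; have cCN := conj_comodule S_bij b cN.
have mT := tens_module S_bij n mM mN; have cT := tens_comodule n cM cN.
have mT' := tens_module S_bij n mCM mCN; have cT' := tens_comodule n cCM cCN.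
have mCT := conj_module S_bij b mT; have cCT := conj_comodule S_bij b cT.
congr (@YdData K H _ _ _); apply/funext => h.
  apply/funext; apply: (@tensor_ext _ M N _) => [||x y].
  - have [_] := act_bilin mCT; exact.
  - have [_] := act_bilin mT'; exact.
  change (act (y := yd_conj b (yd_tens n M N)) h (x ⊗ y) =
    act (y := yd_tens n (yd_conj b M) (yd_conj b N)) h (x ⊗ y)).
  rewrite conj_actE !tens_actE //.
  swl (SD); swr (@conj_actE K H); apply: eq_tsum => c d.
  by rewrite -!(Spow_add S_bij) addrC.
move: h; apply: (@tensor_ext _ M N _) => [||x y].
- exact: lin_coact cCT.
- exact: lin_coact cT'.
change (coact (y := yd_conj b (yd_tens n M N)) (x ⊗ y) =
    coact (y := yd_tens n (yd_conj b M) (yd_conj b N)) (x ⊗ y)).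
rewrite conj_coactE !tens_coactE //.
have SM z := hopf_end_mul (hopf_end_Spow S_bij z).
by swl (SM); swr (@conj_coactE K H).
Qed.

Lemma conj_unit b : yd_conj b (yd_unit H) = yd_unit H.
Proof.
congr (@YdData K H _ _ _); apply/funext => h /=.
  by apply/funext => x; rewrite -mulrN (hopf_end_eps (hopf_end_Spow S_bij _)).
by rewrite tsumE ?(hopf_end_one (hopf_end_Spow S_bij b)) //; lin.
Qed.

Lemma conj_add a b n M : is_yd n M -> yd_conj (a + b) M = yd_conj a (yd_conj b M).
Proof.
move=> yM; have [mM cM _] := yM.
congr (@YdData K H _ _ _); apply/funext => h /=.
  by rewrite -!mulrN -(Spow_add S_bij) -mulrDr opprD addrC.
by swr ((fun h => esym (Spow_add S_bij (2 * a) (2 * b) h)), esym (mulrDr 2 a b)).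
Qed.

Lemma conj0 M : yd_conj 0 M = M.
Proof.
case: M => M a r; congr (@YdData K H _ _ _); apply/funext => h /=.
by rewrite -[RHS]tsum_tpure.
Qed.

Variable w : zmhyd_objects H.

Lemma zconj_tens b (M N : zobj H) :
  zconj w b (ztens w M N) = ztens w (zconj w b M) (zconj w b N).
Proof.
apply: zobj_eq => //; have yM := zobjP M.
exact: conj_tens (zobjP N) (yd_module yM) (yd_comodule yM).
Qed.

Lemma zconj_unit b : zconj w b (zunit w) = zunit w.
Proof. by apply: zobj_eq => //; exact: conj_unit. Qed.

Lemma zconj_add a b (M : zobj H) : zconj w (a + b) M = zconj w a (zconj w b M).
Proof. by apply: zobj_eq => //; exact: conj_add (zobjP M). Qed.

Lemma zconj0 (M : zobj H) : zconj w 0 M = M.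
Proof. by case: M => n M yM; apply: zobj_eq => //; exact: conj0. Qed.

Lemma zconj_zconj_comm a b (M : zobj H) :
  zconj w a (zconj w b M) = zconj w b (zconj w a M).
Proof. by rewrite -!zconj_add addrC. Qed.

Lemma zmor_is_iso (A B : zobj H) (f : zmor A B) (g : B -> A) :
  cancel f g -> cancel g f -> @is_iso (ZMHYD H) A B f.
Proof.
move=> fK gK; have [gl ga gc] := yd_hom_can fK gK (zmor_yd_hom f).
have gz : is_zmor g by split=> //; exact: esym (zmor_deg (zmorP f)).
by exists (ZMor gz); split; apply: zmor_eq.
Qed.

Variable w' : zmhyd_morphisms w.

Lemma zmhyd_is_monoidal : is_monoidal (zmhyd_monoidal w').
Proof.
split.
- by move=> X Y; apply: zmor_eq => t /=; rewrite tmap_id.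
- move=> X X' X'' Y Y' Y'' f' f g' g; apply: zmor_eq => t /=.
  by apply: tmap_comp; exact: yd_hom_lin (zmor_yd_hom _).
- by move=> X Y Z; apply: zmor_eq => t /=; exact: hassocK.
- by move=> X Y Z; apply: zmor_eq => t /=; exact: hassocVK.
- move=> X X' Y Y' Z Z' f g h; apply: zmor_eq => t /=.
  have fl := yd_hom_lin (zmor_yd_hom f); have gl := yd_hom_lin (zmor_yd_hom g).
  have hl := yd_hom_lin (zmor_yd_hom h).
  have fgl : lin (tmap f g) by exact: tmap_linear.
  have ghl : lin (tmap g h) by exact: tmap_linear.
  move: t; apply: tensor3_ext => [||x y z].
  - apply: lin_comp; [exact: lin_hassoc|exact: tmap_linear].
  - apply: lin_comp; [exact: tmap_linear|exact: lin_hassoc].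
  by rewrite !tmap_pure // !hassocE !tmap_pure // zmor_xi zmor_xiV.
- move=> X; exact: (@zmor_is_iso (ztens w (zunit w) X) X (ZMor (zlunit_mor w' X)) _
    (@hlunitK K X) (@hlunitVK K X)).
- move=> X X' f; apply: zmor_eq => t /=.
  have fl := yd_hom_lin (zmor_yd_hom f).
  move: t; apply: tensor_ext => [||x y].
  - by apply: lin_comp; [exact: lin_hlunit|exact: tmap_linear].
  - by apply: lin_comp fl _; exact: lin_hlunit.
  by rewrite tmap_pure // !hlunitE (lin_scaleE _ _ fl) zmor_xi.
- move=> X; exact: (@zmor_is_iso (ztens w X (zunit w)) X (ZMor (zrunit_mor w' X)) _
    (@hrunitK K X) (@hrunitVK K X)).
- move=> X X' f; apply: zmor_eq => t /=.
  have fl := yd_hom_lin (zmor_yd_hom f).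
  move: t; apply: tensor_ext => [||x y].
  - by apply: lin_comp; [exact: lin_hrunit|exact: tmap_linear].
  - by apply: lin_comp fl _; exact: lin_hrunit.
  by rewrite tmap_pure // !hrunitE (lin_scaleE _ _ fl) zmor_xi.
- move=> W X Y Z; apply: zmor_eq => t /=.
  have idl (M : lmodType K) : lin (@id M) by exact: lin_id.
  have aXYZ := @lin_hassoc K X Y Z; have aWXY := @lin_hassoc K W X Y.
  have t1 : lin (tmap (@hassoc K W X Y) (@id Z)) by exact: tmap_linear.
  have t2 : lin (tmap (@id W) (@hassoc K X Y Z)) by exact: tmap_linear.
  move: t; apply: tensor4_ext => [||x y z u].
  - exact: (lin_comp (@lin_hassoc K W X (htens Y Z)) (@lin_hassoc K (htens W X) Y Z)).
  - exact: (lin_comp t2 (lin_comp (@lin_hassoc K W (htens X Y) Z) t1)).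
  rewrite (tmap_pure _ _ aWXY (idl Z)) !hassocE.
  by rewrite (tmap_pure _ _ (idl W) aXYZ) xi_tens !hassocE xiV_tens.
- move=> X Y; apply: zmor_eq => t /=.
  have idl (M : lmodType K) : lin (@id M) by exact: lin_id.
  have ll := @lin_hlunit K Y; have rl := @lin_hrunit K X.
  have t1 : lin (tmap (@id X) (@hlunit K Y)) by exact: tmap_linear.
  have t2 : lin (tmap (@hrunit K X) (@id Y)) by exact: tmap_linear.
  move: t; apply: tensor3_ext => [||x a y].
  - exact: (lin_comp t1 (@lin_hassoc K X (hunit K) Y)).
  - exact: t2.
  rewrite hassocE (tmap_pure _ _ (idl X) ll) (tmap_pure _ _ rl (idl Y)) hlunitE hrunitE.
  by rewrite xiVK tpureZl tpureZr.
Qed.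

Lemma zmhyd_is_strict b :
  is_strict_tensor_functor (zmhyd_monoidal w') (zmhyd_crossed w') b.
Proof.
split.
- by move=> X; apply: zmor_eq.
- by move=> X Y Z g f; apply: zmor_eq.
- exact: zconj_tens.
- exact: zconj_unit.
- move=> X X' Y Y' f g.
  apply: (@zmor_arrow_eq (zconj w b (ztens w X Y)) (ztens w (zconj w b X) (zconj w b Y))
    (zconj w b (ztens w X' Y')) (ztens w (zconj w b X') (zconj w b Y')) _ _ erefl erefl) => //;
  exact: zconj_tens.
- move=> X Y Z.
  apply: (@zmor_arrow_eq (zconj w b (ztens w (ztens w X Y) Z))
    (ztens w (ztens w (zconj w b X) (zconj w b Y)) (zconj w b Z))
    (zconj w b (ztens w X (ztens w Y Z)))
    (ztens w (zconj w b X) (ztens w (zconj w b Y) (zconj w b Z))) _ _ erefl erefl) => //;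
  by rewrite !zconj_tens.
- move=> X.
  apply: (@zmor_arrow_eq (zconj w b (ztens w (zunit w) X)) (ztens w (zunit w) (zconj w b X))
    (zconj w b X) (zconj w b X) _ _ erefl erefl) => //.
  by rewrite zconj_tens zconj_unit.
- move=> X.
  apply: (@zmor_arrow_eq (zconj w b (ztens w X (zunit w))) (ztens w (zconj w b X) (zunit w))
    (zconj w b X) (zconj w b X) _ _ erefl erefl) => //.
  by rewrite zconj_tens zconj_unit.
Qed.

Lemma zmhyd_is_crossed : is_crossed (zmhyd_monoidal w') (zmhyd_crossed w').
Proof.
split.
- exact: zmhyd_is_monoidal.
- by move=> X Y f; exact: zmor_deg (zmorP f).
- by [].
- exact: zmhyd_is_strict.
- exact: zconj0.
- move=> X Y f.
  by apply: (@zmor_arrow_eq (zconj w 0 X) X (zconj w 0 Y) Y _ _ erefl erefl) => //;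
  exact: zconj0.
- exact: zconj_add.
- move=> a b X Y f.
  by apply: (@zmor_arrow_eq (zconj w (a + b) X) (zconj w a (zconj w b X))
    (zconj w (a + b) Y) (zconj w a (zconj w b Y)) _ _ erefl erefl) => //; exact: zconj_add.
- move=> a b V.
  (* The index group is abelian, so conjugation does not move components. *)
  change (zdeg V = (b + a) - b <-> exists2 U : zobj H, zdeg U = a & zconj w b U = V).
  rewrite [b + a]addrC addrK; split=> [dV|[U dU <-] //].
  by exists (zconj w (- b) V) => //; rewrite -zconj_add subrr zconj0.
Qed.

Lemma zmhyd_is_braiding : is_braiding (zmhyd_braiding w').
Proof.
have mod (M : zobj H) : is_hom_module M := yd_module (zobjP M).
have com (M : zobj H) : is_hom_comodule M := yd_comodule (zobjP M).
split.
- move=> U V.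
  exact: (@zmor_is_iso (ztens w U V) (ztens w (zconj w (zdeg U) V) U)
    (ZMor (zbraid_mor w' U V)) _ (braidK (mod U) (com V)) (braidVK (mod U) (com V))).
- move=> U U' V V' f g.
  apply: (@zmor_arrow_eq (ztens w U V) (ztens w U V) (ztens w (zconj w (zdeg U) V') U')
    (ztens w (zconj w (zdeg U') V') U') _ _ erefl erefl) => //.
    by rewrite (zmor_deg (zmorP f)).
  move=> t /=; apply: braid_natural => //; try exact: zmor_yd_hom.
  + by move=> y; rewrite zmor_xi.
  + by move=> x; rewrite zmor_xiV.
- move=> U V W.
  apply: (@zmor_arrow_eq (ztens w (ztens w U V) W) (ztens w (ztens w U V) W)
    (ztens w (zconj w (zdeg U + zdeg V) W) (ztens w U V))
    (ztens w (zconj w (zdeg U) (zconj w (zdeg V) W)) (ztens w U V)) _ _ erefl erefl) => //.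
    by rewrite zconj_add.
  by move=> t; exact: (hexagon_l S_bij (mod U) (mod V) (com W)).
- move=> U V W.
  apply: (@zmor_arrow_eq (ztens w U (ztens w V W)) (ztens w U (ztens w V W))
    (ztens w (zconj w (zdeg U) (ztens w V W)) U)
    (ztens w (ztens w (zconj w (zdeg U) V) (zconj w (zdeg U) W)) U) _ _ erefl erefl) => //.
    by rewrite zconj_tens.
  by move=> t; exact: (hexagon_r (mod U) (com V) (com W)).
- move=> b U V.
  apply: (@zmor_arrow_eq (zconj w b (ztens w U V)) (ztens w (zconj w b U) (zconj w b V))
    (zconj w b (ztens w (zconj w (zdeg U) V) U))
    (ztens w (zconj w (zdeg U) (zconj w b V)) (zconj w b U)) _ _ erefl erefl).
  + exact: zconj_tens.
  + by rewrite zconj_tens zconj_zconj_comm.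
  by move=> t; exact: (@braid_conj K H S_bij b U V t (mod U) (com V)).
Qed.

End Equalities.

Theorem corollary4p12 (K : fieldType) (H : homHopf K) :
  bijective (antipode H) ->
  exists (w : zmhyd_objects H) (w' : zmhyd_morphisms w),
    is_braided_T_category (zmhyd_braiding w').
Proof.
move=> S_bij; exists (zmhyd_objectsP S_bij), (zmhyd_morphismsP S_bij _).
by split; [exact: zmhyd_is_crossed | exact: zmhyd_is_braiding].
Qed.
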